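(* Let $X,U$ be Hilbert spaces, let $A$ generate a strongly continuous semigroup $T(t)$ on $X$, let $B\in\mathcal{B}(U,X)$, and let $F\in\mathcal{B}(X,U)$ be compact. Assume that the semigroup $T_{BF}(t)$ generated by $A+BF$ is exponentially stable, i.e., $\|T_{BF}(t)\|_{\mathcal{B}(X)}\le\Gamma e^{-\gamma t}$ for all $t\ge0$, for some $\Gamma\ge1$ and $\gamma>0$. Then for every $\tau_{\max}>0$ there exist constants $L^*,\varepsilon^*>0$ and $\tau_{\min}^*\in(0,\tau_{\max})$ such that for every $L\in[0,L^*]$, every $\phi:X\to X$ satisfying $\phi(0)=0$ and $\|\phi(\xi_1)-\phi(\xi_2)\|\le L\|\xi_1-\xi_2\|$ for all $\xi_1,\xi_2\in X$, every $\varepsilon\in[0,\varepsilon^*]$ and every $\tau_{\min}\in(0,\tau_{\min}^*]$, the closed-loop system with the event-triggering mechanism (described in the context) with parameters $\varepsilon,\tau_{\min},\tau_{\max}$ is exponentially stable.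
   Context: $\mathcal{B}(Y,Z)$ is the space of bounded linear operators from $Y$ to $Z$, $\mathcal{B}(X)=\mathcal{B}(X,X)$, $\mathbb{N}_0=\{0,1,2,\dots\}$, and $\|\cdot\|$ is the norm of $X$. Closed-loop system: $\dot x(t)=Ax(t)+Bu(t)+\phi(x(t))$, $t\ge0$, $x(0)=x^0\in X$, with $u(t)=Fx(t_k)$ for $t_k\le t<t_{k+1}$, $k\in\mathbb{N}_0$. Its (mild) solution is the unique function $x\in C([0,\infty),X)$ with $x(0)=x^0$ and $$x(t_k+\tau)=T(\tau)x(t_k)+\int_0^\tau T(\tau-s)\big(BFx(t_k)+\phi(x(t_k+s))\big)ds$$ for all $\tau\in(0,t_{k+1}-t_k]$, $k\in\mathbb{N}_0$. Event-triggering mechanism with threshold $\varepsilon\ge0$ and bounds $0<\tau_{\min}<\tau_{\max}$: $t_0:=0$, $t_{k+1}:=\min\{t_k+\tau_{\max},\bar t_{k+1}\}$, where $$\bar t_{k+1}:=\inf\{t>t_k+\tau_{\min}:\|x(t_k)-x(t)\|>\varepsilon\|x(t_k)\|\},\quad k\in\mathbb{N}_0$$ (with $\inf\emptyset=\infty$). The times and the solution are generated recursively: in the definition of $\bar t_{k+1}$, $x(t)$ for $t>t_k$ is the trajectory obtained by keeping the input $u=Fx(t_k)$ after $t_k$. Exponential stability of the closed-loop system: there exist constants $\Gamma_0\ge1$, $\gamma_0>0$ such that the solution satisfies $\|x(t)\|\le\Gamma_0e^{-\gamma_0t}\|x^0\|$ for all $x^0\in X$ and all $t\ge0$. *)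

(* Defs.v *)
From Stdlib Require Import Reals List.
From Coquelicot Require Import Coquelicot.
Open Scope R_scope.

(* Real and complex Hilbert spaces are treated uniformly: [k] is the choice of
   the scalar field. *)
Inductive scalar_field := RealScalars | ComplexScalars.

Definition scalars (k : scalar_field) : AbsRing :=
  match k with RealScalars => R_AbsRing | ComplexScalars => C_AbsRing end.

Definition of_real (k : scalar_field) : R -> scalars k :=
  match k with RealScalars => fun r => r | ComplexScalars => RtoC end.

Definition conjugate (k : scalar_field) : scalars k -> scalars k :=
  match k with RealScalars => fun r => r | ComplexScalars => Cconj end.

Record Hilbert (k : scalar_field) := {
  hilbert_space :> CompleteNormedModule (scalars k);
  inner : hilbert_space -> hilbert_space -> scalars k;
  inner_plus_l : forall x y z,
    inner (plus x y) z = plus (inner x z) (inner y z);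
  inner_scal_l : forall (a : scalars k) x y,
    inner (scal a x) y = mult a (inner x y);
  inner_conj : forall x y, inner y x = conjugate k (inner x y);
  inner_norm : forall x, inner x x = of_real k (norm x ^ 2)
}.

Arguments hilbert_space {k}.
Arguments inner {k}.

(* Restriction of scalars to R: same carrier, norm and topology. Coquelicot's
   Riemann integral is only defined for modules over R. *)
Section Realification.

Context (k : scalar_field) (X : CompleteNormedModule (scalars k)).

Definition real_scal (r : R) (x : X) : X := scal (of_real k r) x.

Lemma real_scal_assoc (r s : R) (x : X) :
  real_scal r (real_scal s x) = real_scal (r * s) x.
Proof.
  unfold real_scal; rewrite scal_assoc; f_equal.
  destruct k; simpl; [reflexivity | symmetry; apply RtoC_mult].
Qed.

Lemma real_scal_one (x : X) : real_scal 1 x = x.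
Proof.
  unfold real_scal; transitivity (scal (@one (scalars k)) x);
    [destruct k; reflexivity | apply scal_one].
Qed.

Lemma real_scal_distr_l (r : R) (x y : X) :
  real_scal r (plus x y) = plus (real_scal r x) (real_scal r y).
Proof. apply (scal_distr_l (V := X)). Qed.

Lemma real_scal_distr_r (r s : R) (x : X) :
  real_scal (r + s) x = plus (real_scal r x) (real_scal s x).
Proof.
  unfold real_scal.
  etransitivity; [| apply (scal_distr_r (V := X))]; f_equal.
  destruct k; simpl; [reflexivity | apply RtoC_plus].
Qed.

Lemma real_scal_norm (r : R) (x : X) : norm (real_scal r x) <= Rabs r * norm x.
Proof.
  unfold real_scal; eapply Rle_trans; [apply (norm_scal (V := X)) | right; f_equal].
  destruct k; simpl; [reflexivity | apply Cmod_R].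
Qed.

Definition real_module_class : ModuleSpace.class_of R_Ring X :=
  ModuleSpace.Class R_Ring X (AbelianGroup.class X)
    (ModuleSpace.Mixin R_Ring X real_scal real_scal_assoc real_scal_one
       real_scal_distr_l real_scal_distr_r).

Definition real_normed_aux : NormedModuleAux R_AbsRing :=
  NormedModuleAux.Pack R_AbsRing X
    (NormedModuleAux.Class R_AbsRing X real_module_class (UniformSpace.class X))
    X.

Definition real_normed_mixin : NormedModule.mixin_of R_AbsRing real_normed_aux :=
  NormedModule.Mixin R_AbsRing real_normed_aux (@norm _ X) (@norm_factor _ X)
    (@norm_triangle _ X) real_scal_norm (@norm_compat1 _ X)
    (@norm_compat2 _ X) (@norm_eq_zero _ X).

Definition realification : CompleteNormedModule R_AbsRing :=
  CompleteNormedModule.Pack R_AbsRing X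
    (CompleteNormedModule.Class R_AbsRing X
       (NormedModule.Class R_AbsRing X
          (NormedModuleAux.class R_AbsRing real_normed_aux) real_normed_mixin)
       (CompleteNormedModule.mixin _ _ (CompleteNormedModule.class _ X)))
    X.

End Realification.

Arguments realification {k}.

(* Bounded operators are rendered by Coquelicot's [is_linear], which includes
   boundedness. *)
Section Operators.

Context {K : AbsRing} {Y Z : NormedModule K}.

Definition op_norm (f : Y -> Z) : Rbar :=
  Lub_Rbar (fun r => exists y : Y, norm y <= 1 /\ r = norm (f y)).

Definition closure (S : Z -> Prop) (z : Z) : Prop :=
  forall P : Z -> Prop, locally z P -> exists z', P z' /\ S z'.

Definition compact_set (S : Z -> Prop) : Prop :=
  forall (I : Type) (O : I -> Z -> Prop),
    (forall i, open (O i)) ->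
    (forall z, S z -> exists i, O i z) ->
    exists l : list I, forall z, S z -> exists i, In i l /\ O i z.

Definition compact_operator (f : Y -> Z) : Prop :=
  is_linear f /\
  compact_set (closure (fun z => exists y : Y, norm y <= 1 /\ z = f y)).

End Operators.

Section Semigroups.

Context {k : scalar_field} {X : Hilbert k}.

(* The values of [T] at negative times are irrelevant. *)
Definition C0_semigroup (T : R -> X -> X) : Prop :=
  (forall t, 0 <= t -> is_linear (T t)) /\
  (forall x, T 0 x = x) /\
  (forall s t x, 0 <= s -> 0 <= t -> T (s + t) x = T s (T t x)) /\
  (forall x, filterlim (fun t => T t x) (at_right 0) (locally x)).

(* The operator with domain [D] that agrees with [A] on [D] generates [T];
   the values of [A] outside [D] are irrelevant. *)
Definition generates (D : X -> Prop) (A : X -> X) (T : R -> X -> X) : Prop :=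
  C0_semigroup T /\
  forall x y : X,
    (D x /\ A x = y) <->
    filterlim (fun h => scal (of_real k (/ h)) (minus (T h x) x))
      (at_right 0) (locally y).

Definition exp_stable_semigroup (T : R -> X -> X) : Prop :=
  exists Gam gam : R, 1 <= Gam /\ 0 < gam /\
    forall t, 0 <= t -> Rbar_le (op_norm (T t)) (Gam * exp (- gam * t)).

End Semigroups.

Definition lipschitz {K : AbsRing} {X : NormedModule K} (L : R) (phi : X -> X)
  : Prop :=
  forall x1 x2 : X, norm (minus (phi x1) (phi x2)) <= L * norm (minus x1 x2).

Section ClosedLoop.

Context {k : scalar_field} {X U : Hilbert k}.
Context (T : R -> X -> X) (B : U -> X) (F : X -> U) (phi : X -> X).

(* Variation-of-constants formula at time [tau] after a sampling time, for a
   trajectory [z] whose clock is reset to 0 at that sampling time and to which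
   the constant input [F (z 0)] is applied. *)
Definition mild_formula (z : R -> X) (tau : R) : Prop :=
  exists I : X,
    is_RInt (V := realification X)
      (fun s => T (tau - s) (plus (B (F (z 0))) (phi (z s)))) 0 tau I /\
    z tau = plus (T tau (z 0)) I.

(* The trajectory from [xi] when the input [F xi] is kept forever. *)
Definition held_trajectory (xi : X) (z : R -> X) : Prop :=
  continuous_on (fun s => 0 <= s) z /\
  z 0 = xi /\
  forall tau, 0 < tau -> mild_formula z tau.

(* [tbar]: the infimum is p_infty on the empty set. *)
Definition trigger_time (eps tau_min tk : R) (z : R -> X) : Rbar :=
  Glb_Rbar (fun t => t > tk + tau_min /\
                     norm (minus (z 0) (z (t - tk))) > eps * norm (z 0)).

(* [t] is the sequence of updating times and [x] the mild solution. The held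
   trajectory [z] coincides with [fun s => x (t n + s)] up to [t (S n)], by
   uniqueness of mild solutions; beyond [t (S n)] only [z] keeps the input
   [F (x (t n))]. *)
Definition closed_loop_solution (eps tau_min tau_max : R) (x0 : X)
    (t : nat -> R) (x : R -> X) : Prop :=
  continuous_on (fun s => 0 <= s) x /\
  x 0 = x0 /\
  t 0%nat = 0 /\
  forall n : nat,
    (forall tau, 0 < tau <= t (S n) - t n ->
       mild_formula (fun s => x (t n + s)) tau) /\
    exists z : R -> X,
      held_trajectory (x (t n)) z /\
      Finite (t (S n)) =
        Rbar_min (t n + tau_max) (trigger_time eps tau_min (t n) z).

Definition closed_loop_exp_stable (eps tau_min tau_max : R) : Prop :=
  exists Gam0 gam0 : R, 1 <= Gam0 /\ 0 < gam0 /\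
    forall (x0 : X) (t : nat -> R) (x : R -> X),
      closed_loop_solution eps tau_min tau_max x0 t x ->
      forall s, 0 <= s -> norm (x s) <= Gam0 * exp (- gam0 * s) * norm x0.

End ClosedLoop.

(* Main.v *)
Require Import Defs.
From Stdlib Require Import Arith Reals Lra Lia List Classical ClassicalEpsilon.
From Coquelicot Require Import Coquelicot.
Open Scope R_scope.

(** Write [S] for the semigroup of [A + B F]. Along a trajectory, on an interval
    that starts at an updating time [t_k], the state solves the equation of [S]
    with the forcing term [B F (x(t_k) - x(t)) + phi (x(t))]. The theorem holds
    because this term is a small multiple of [norm (x(t_k))] on the whole interval:

    - the nonlinearity contributes at most [L * norm (x(t))], and the state grows
      by at most a fixed factor over a time [tau_max] ([mild_growth]);
    - after [t_k + tau_min] the event trigger bounds the sampling error by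
      [eps * norm (x(t_k))] ([updating_time_bounds]);
    - before [t_k + tau_min] the trigger is silent, and the sampling error itself
      need not be small compared with the state, but its image under [F] is: up to
      terms of order [tau_min] it is [F (T(t) - 1) x(t_k)], and [F (T(t) - 1)]
      tends to 0 in operator norm ([compact_semigroup_norm_continuous]). This is
      where compactness of [F] and the Hilbert space structure enter: the adjoint
      semigroup is strongly continuous ([adjoint_semigroup_continuous]), and
      compactness upgrades weak smallness to smallness in norm.

    In a norm adapted to [S] ([adapted_norm_exists]), in which every [S(h)] is a
    contraction by [exp (- gam * h)], such a forcing term leaves a contraction over
    each updating interval ([sampling_interval_decay]). Its factor is uniform
    because the intervals are at least [tau_min] long, and exponential decay follows
    by counting intervals ([decay_along_updating_times]).

    The variation of constants formula for [S] is never written down. Instead,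
    [T(h) x - S(h) x = - h B F x + o(h)] is proved for every vector [x]
    ([semigroup_difference_derivative]): on the domain this compares the two
    generators, and it extends by density since [T(h) - S(h)] is of order [h] in
    operator norm. Consequently a mild solution for [T] has a first-order expansion
    along [S] ([mild_expansion]), and its decay estimate reduces to a statement
    about right Dini derivatives of real functions ([dini_nonincreasing]).

    Complex spaces are treated as real ones, with the real part of the inner
    product. *)

(** * Linear identities in real modules *)

Section LinearIdentities.

Context {V : ModuleSpace R_Ring}.

Inductive linear_expr :=
  | LVar (n : nat)
  | LZero
  | LPlus (a b : linear_expr)
  | LOpp (a : linear_expr)
  | LScal (r : R) (a : linear_expr).

Fixpoint linear_eval (env : list V) (e : linear_expr) : V :=
  match e with
  | LVar n => nth n env zero
  | LZero => zero
  | LPlus a b => plus (linear_eval env a) (linear_eval env b)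
  | LOpp a => opp (linear_eval env a)
  | LScal r a => scal r (linear_eval env a)
  end.

Fixpoint linear_coef (e : linear_expr) (n : nat) : R :=
  match e with
  | LVar m => if Nat.eqb m n then 1 else 0
  | LZero => 0
  | LPlus a b => linear_coef a n + linear_coef b n
  | LOpp a => - linear_coef a n
  | LScal r a => r * linear_coef a n
  end.

Fixpoint linear_comb (c : nat -> R) (env : list V) : V :=
  match env with
  | nil => zero
  | v :: l => plus (scal (c O) v) (linear_comb (fun n => c (S n)) l)
  end.

Lemma linear_comb_zero env : linear_comb (fun _ => 0) env = zero.
Proof.
  induction env as [|v env IH]; simpl; [reflexivity|].
  rewrite IH, plus_zero_r. apply (scal_zero_l v).
Qed.

Lemma linear_comb_plus c d env :
  linear_comb (fun n => c n + d n) env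
  = plus (linear_comb c env) (linear_comb d env).
Proof.
  revert c d; induction env as [|v env IH]; intros c d; simpl.
  - now rewrite plus_zero_r.
  - rewrite (IH (fun n => c (S n)) (fun n => d (S n))).
    replace (scal (c O + d O) v) with (plus (scal (c O) v) (scal (d O) v))
      by (symmetry; apply (scal_distr_r (c O) (d O) v)).
    rewrite <- !plus_assoc. f_equal.
    rewrite !plus_assoc. f_equal. apply plus_comm.
Qed.

Lemma linear_comb_scal r c env :
  linear_comb (fun n => r * c n) env = scal r (linear_comb c env).
Proof.
  revert c; induction env as [|v env IH]; intros c; simpl.
  - now rewrite scal_zero_r.
  - rewrite (IH (fun n => c (S n))), scal_distr_l. f_equal.
    symmetry; apply (scal_assoc r (c O) v).
Qed.

Lemma linear_comb_var m env :
  linear_comb (fun n => if Nat.eqb m n then 1 else 0) env = nth m env zero.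
Proof.
  revert m; induction env as [|v env IH]; intros [|m]; simpl; try reflexivity.
  - rewrite linear_comb_zero, plus_zero_r. apply (scal_one v).
  - rewrite IH. transitivity (plus zero (nth m env zero));
      [f_equal; apply (scal_zero_l v) | apply plus_zero_l].
Qed.

Lemma linear_comb_ext c d env :
  (forall n, c n = d n) -> linear_comb c env = linear_comb d env.
Proof.
  revert c d; induction env as [|v env IH]; intros c d H; simpl; [reflexivity|].
  rewrite H. f_equal. now apply IH.
Qed.

Lemma linear_eval_comb env e :
  linear_eval env e = linear_comb (linear_coef e) env.
Proof.
  induction e as [n| |a IHa b IHb|a IHa|r a IHa]; simpl.
  - now rewrite linear_comb_var.
  - now rewrite linear_comb_zero.
  - now rewrite linear_comb_plus, IHa, IHb.
  - rewrite (linear_comb_ext _ (fun n => (-1) * linear_coef a n))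
      by (intros; ring).
    rewrite linear_comb_scal, IHa. symmetry; apply (scal_opp_one (linear_comb _ env)).
  - now rewrite linear_comb_scal, IHa.
Qed.

Fixpoint coefs_agree (c d : nat -> R) (n : nat) : Prop :=
  match n with
  | O => True
  | S n => c O = d O /\ coefs_agree (fun i => c (S i)) (fun i => d (S i)) n
  end.

(** Two linear expressions with the same coefficients on every atom are equal;
    this reduces vector identities to identities between real numbers. *)
Lemma linear_eval_eq env a b :
  coefs_agree (linear_coef a) (linear_coef b) (length env) ->
  linear_eval env a = linear_eval env b.
Proof.
  rewrite !linear_eval_comb.
  generalize (linear_coef a) (linear_coef b).
  induction env as [|v env IH]; simpl; intros c d H; [reflexivity|].
  destruct H as [H0 H]. rewrite H0. f_equal. now apply IH.
Qed.

End LinearIdentities.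

Ltac atom_index x env :=
  match env with
  | cons x _ => constr:(O)
  | cons _ ?l => let n := atom_index x l in constr:(S n)
  end.

Ltac add_atom x env :=
  match env with
  | context [cons x _] => env
  | _ => constr:(cons x env)
  end.

Ltac linear_atoms env e :=
  lazymatch e with
  | plus ?a ?b => let env := linear_atoms env a in linear_atoms env b
  | minus ?a ?b => let env := linear_atoms env a in linear_atoms env b
  | opp ?a => linear_atoms env a
  | scal _ ?a => linear_atoms env a
  | zero => env
  | _ => add_atom e env
  end.

Ltac linear_reify env e :=
  lazymatch e with
  | plus ?a ?b =>
      let a := linear_reify env a in let b := linear_reify env b in
      constr:(LPlus a b)
  | minus ?a ?b =>
      let a := linear_reify env a in let b := linear_reify env b in
      constr:(LPlus a (LOpp b))
  | opp ?a => let a := linear_reify env a in constr:(LOpp a)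
  | scal ?r ?a => let a := linear_reify env a in constr:(LScal r a)
  | zero => constr:(LZero)
  | _ => let n := atom_index e env in constr:(LVar n)
  end.

(** Solves equalities between linear combinations, up to real identities that
    [field] proves; side conditions on denominators must be in context. *)
Ltac linear_module :=
  lazymatch goal with
  | |- @eq ?T ?a ?b =>
      let env := linear_atoms (@nil T) a in
      let env := linear_atoms env b in
      let ea := linear_reify env a in
      let eb := linear_reify env b in
      refine (linear_eval_eq env ea eb _);
      cbn -[Rplus Rmult Ropp Rinv IZR];
      repeat split; (ring || (field; auto))
  end.


(** * Limits and integrals in normed spaces *)

(** The norm axioms and linearity are restated for complete normed modules over
    the reals: every term is then built through the same canonical structures, as
    rewriting and [lra] require. *)
Section NormFacts.

Context {V : CompleteNormedModule R_AbsRing}.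

Lemma norm_nonneg (x : V) : 0 <= norm x.
Proof. apply (norm_ge_0 x). Qed.

Lemma norm_plus_le (x y : V) : norm (plus x y) <= norm x + norm y.
Proof. apply (norm_triangle x y). Qed.

Lemma norm_of_opp (x : V) : norm (opp x) = norm x.
Proof. apply (norm_opp x). Qed.

Lemma norm_of_zero : norm (@zero (CompleteNormedModule.AbelianMonoid _ V)) = 0.
Proof. apply (@norm_zero _ V). Qed.

Lemma norm_zero_inv (x : V) : norm x = 0 -> x = zero.
Proof. apply (norm_eq_zero x). Qed.

Lemma norm_minus_le (x y : V) : norm (minus x y) <= norm x + norm y.
Proof. rewrite <- (norm_of_opp y). apply norm_plus_le. Qed.

Lemma norm_scal_le (r : R) (x : V) : norm (scal r x) <= Rabs r * norm x.
Proof. apply (norm_scal r x). Qed.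

Lemma norm_scal_eq (r : R) (x : V) : norm (scal r x) = Rabs r * norm x.
Proof.
  apply Rle_antisym; [apply norm_scal_le|].
  destruct (Req_dec r 0) as [->|Hr].
  - rewrite Rabs_R0, Rmult_0_l. apply norm_nonneg.
  - replace (norm x) with (norm (scal (/ r) (scal r x))) by (f_equal; linear_module).
    eapply Rle_trans;
      [apply Rmult_le_compat_l; [apply Rabs_pos|apply norm_scal_le]|].
    rewrite Rabs_inv. right; field. now apply Rabs_no_R0.
Qed.

Lemma norm_scal_pos (r : R) (x : V) : 0 <= r -> norm (scal r x) = r * norm x.
Proof. intros Hr. rewrite norm_scal_eq, Rabs_right; [reflexivity|lra]. Qed.

Lemma norm_minus_self (x : V) : norm (minus x x) = 0.
Proof.
  rewrite <- norm_of_zero. f_equal. linear_module.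
Qed.

Lemma norm_minus_sym (x y : V) : norm (minus x y) = norm (minus y x).
Proof. rewrite <- norm_of_opp. f_equal. linear_module. Qed.

Lemma norm_minus_triangle (x y z : V) :
  norm (minus x z) <= norm (minus x y) + norm (minus y z).
Proof.
  replace (minus x z) with (plus (minus x y) (minus y z)) by linear_module.
  apply norm_plus_le.
Qed.

Lemma norm_le_minus (x y : V) : norm x <= norm y + norm (minus x y).
Proof.
  replace x with (plus y (minus x y)) at 1 by linear_module.
  apply norm_plus_le.
Qed.

End NormFacts.

Section LinearFacts.

Context {V W : CompleteNormedModule R_AbsRing} {l : V -> W}.

Lemma lin_plus (Hl : is_linear l) (x y : V) : l (plus x y) = plus (l x) (l y).
Proof. apply (linear_plus l Hl). Qed.

Lemma lin_scal (Hl : is_linear l) (r : R) (x : V) : l (scal r x) = scal r (l x).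
Proof. apply (linear_scal l Hl). Qed.

Lemma lin_minus (Hl : is_linear l) (x y : V) : l (minus x y) = minus (l x) (l y).
Proof. apply (linear_minus l x y Hl). Qed.

Lemma lin_zero (Hl : is_linear l) : l zero = zero.
Proof. apply (linear_zero l Hl). Qed.

End LinearFacts.

Section EpsilonDelta.

Context {K : AbsRing} {V : NormedModule K}.

Lemma filterlim_at_right_norm (f : R -> V) (y : V) :
  filterlim f (at_right 0) (locally y) <->
  forall e, 0 < e -> exists d, 0 < d /\
    forall h, 0 < h < d -> norm (minus (f h) y) < e.
Proof.
  rewrite (filterlim_locally_ball_norm f y). split.
  - intros H e He. destruct (H (mkposreal e He)) as [d Hd].
    exists d; split; [apply cond_pos|]. intros h Hh.
    apply Hd; [|lra].
    unfold ball; simpl; unfold AbsRing_ball, minus, plus, opp, abs; simpl.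
    rewrite Rabs_right; lra.
  - intros H e. destruct (H e (cond_pos e)) as (d & Hd & Hh).
    exists (mkposreal d Hd). intros h Hb Hpos. apply Hh. split; [exact Hpos|].
    unfold ball in Hb; simpl in Hb;
      unfold AbsRing_ball, minus, plus, opp, abs in Hb; simpl in Hb.
    rewrite Rabs_right in Hb; lra.
Qed.

Lemma continuous_on_nonneg_norm (f : R -> V) :
  continuous_on (fun s => 0 <= s) f ->
  forall s, 0 <= s -> forall e, 0 < e -> exists d, 0 < d /\
    forall r, 0 <= r -> Rabs (r - s) < d -> norm (minus (f r) (f s)) < e.
Proof.
  intros H s Hs e He. specialize (H s Hs).
  assert (FF : Filter (within (fun s => 0 <= s) (locally s)))
    by apply within_filter, locally_filter.
  apply (proj1 (filterlim_locally_ball_norm (FF := FF) f (f s)))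
    with (eps := mkposreal e He) in H.
  destruct H as [d Hd]. exists d; split; [apply cond_pos|].
  intros r Hr Hrs. apply Hd; [exact Hrs|exact Hr].
Qed.

End EpsilonDelta.

Definition continuous_nonneg {V : CompleteNormedModule R_AbsRing} (f : R -> V) : Prop :=
  forall s, 0 <= s -> forall e, 0 < e -> exists d, 0 < d /\
    forall r, 0 <= r -> Rabs (r - s) < d -> norm (minus (f r) (f s)) < e.

(** Precomposing with [Rabs] extends the function past 0, so that two-sided
    continuity, the form used by integration and compactness, is available. *)
Lemma continuous_nonneg_Rabs {V : CompleteNormedModule R_AbsRing} (f : R -> V) :
  continuous_nonneg f -> forall s, continuous (fun r => f (Rabs r)) s.
Proof.
  intros H s. apply (proj2 (filterlim_locally_ball_norm _ (f (Rabs s)))).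
  intros e. destruct (H (Rabs s) (Rabs_pos s) e (cond_pos e)) as (d & Hd & Hr).
  exists (mkposreal d Hd). intros r Hrs. apply Hr; [apply Rabs_pos|].
  eapply Rle_lt_trans; [apply Rabs_triang_inv2|]. exact Hrs.
Qed.

Lemma continuous_nonneg_shift {V : CompleteNormedModule R_AbsRing} (f : R -> V) (a : R) :
  0 <= a -> continuous_nonneg f -> continuous_nonneg (fun s => f (a + s)).
Proof.
  intros Ha H s Hs e He. destruct (H (a + s)) with (e := e) as (d & Hd & Hr); try lra.
  exists d; split; [lra|]. intros r Hr0 Hrs. apply Hr; [lra|].
  now replace (a + r - (a + s)) with (r - s) by ring.
Qed.

Lemma continuous_nonneg_minus {V : CompleteNormedModule R_AbsRing} (f g : R -> V) :
  continuous_nonneg f -> continuous_nonneg g ->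
  continuous_nonneg (fun s => minus (f s) (g s)).
Proof.
  intros Hf Hg s Hs e He.
  destruct (Hf s Hs (e / 2)) as (d1 & Hd1 & H1); [lra|].
  destruct (Hg s Hs (e / 2)) as (d2 & Hd2 & H2); [lra|].
  exists (Rmin d1 d2); split; [now apply Rmin_pos|]. intros r Hr Hrs.
  specialize (H1 r Hr (Rlt_le_trans _ _ _ Hrs (Rmin_l _ _))).
  specialize (H2 r Hr (Rlt_le_trans _ _ _ Hrs (Rmin_r _ _))).
  replace (minus (minus (f r) (g r)) (minus (f s) (g s)))
    with (minus (minus (f r) (f s)) (minus (g r) (g s))) by linear_module.
  eapply Rle_lt_trans; [apply norm_minus_le|]. lra.
Qed.

Lemma norm_attains_max {V : CompleteNormedModule R_AbsRing} (f : R -> V) (a : R) :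
  0 <= a -> continuous_nonneg f ->
  exists m, 0 <= m <= a /\ forall s, 0 <= s <= a -> norm (f s) <= norm (f m).
Proof.
  intros Ha Hf.
  destruct (continuity_ab_maj (fun s => norm (f (Rabs s))) 0 a Ha) as (m & Hmax & Hm).
  - intros c _. apply continuity_pt_filterlim.
    apply (filterlim_comp _ _ _ (fun s => f (Rabs s)) norm) with (G := locally (f (Rabs c))).
    + exact (continuous_nonneg_Rabs f Hf c).
    + apply (filterlim_norm (f (Rabs c))).
  - exists m; split; [exact Hm|]. intros s Hs. specialize (Hmax s Hs). simpl in Hmax.
    rewrite !Rabs_right in Hmax by lra. exact Hmax.
Qed.

Lemma cauchy_sequence_converges {V : CompleteNormedModule R_AbsRing} (x : nat -> V) :
  (forall e, 0 < e -> exists n, forall m p, (n <= m)%nat -> (n <= p)%nat ->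
     norm (minus (x m) (x p)) < e) ->
  exists l, forall e, 0 < e -> exists n, forall m, (n <= m)%nat ->
     norm (minus (x m) l) < e.
Proof.
  intros H.
  destruct (proj1 (filterlim_locally_cauchy (F := eventually) x)) as [l Hl].
  - intros e. destruct (H e (cond_pos e)) as [n Hn].
    exists (fun v => (n <= v)%nat). split; [now exists n|].
    intros u v Hu Hv. apply (norm_compat1 (x u) (x v) e). now apply Hn.
  - exists l. intros e He.
    destruct (proj1 (filterlim_locally_ball_norm x l) Hl (mkposreal e He)) as [n Hn].
    exists n. exact Hn.
Qed.

Lemma is_RInt_linear {V W : CompleteNormedModule R_AbsRing} (l : V -> W) (f : R -> V)
    (a b : R) (I : V) :
  is_linear l -> is_RInt f a b I -> is_RInt (fun s => l (f s)) a b (l I).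
Proof.
  intros Hl HI.
  assert (Hsum : forall p, Riemann_sum (fun s => l (f s)) p = l (Riemann_sum f p)).
  { intros p. induction p as [x0|h p IH] using SF_cons_ind.
    - symmetry. apply (linear_zero l Hl).
    - transitivity (l (plus (scal (SF_h p - fst h) (f (snd h))) (Riemann_sum f p))).
      + rewrite (lin_plus Hl), (lin_scal Hl), <- IH.
        apply (Riemann_sum_cons (fun s => l (f s)) h p).
      + f_equal. symmetry. apply (Riemann_sum_cons f h p). }
  unfold is_RInt.
  apply filterlim_ext with
    (f := fun p => l (scal (sign (b - a)) (Riemann_sum f p))).
  { intros p. rewrite Hsum. apply (lin_scal Hl). }
  eapply filterlim_comp; [exact HI|]. exact (linear_cont l I Hl).
Qed.

(** Integrals over short intervals are differentiated through this estimate, with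
    [v] the value of the integrand at the left end. *)
Lemma is_RInt_near_const {V : CompleteNormedModule R_AbsRing} (f : R -> V) (a b : R)
    (I v : V) (e : R) :
  a <= b -> is_RInt f a b I ->
  (forall s, a <= s <= b -> norm (minus (f s) v) <= e) ->
  norm (minus I (scal (b - a) v)) <= (b - a) * e.
Proof.
  intros Hab HI He.
  apply norm_RInt_le_const with (f := fun s => minus (f s) v) (1 := Hab) (2 := He).
  apply (is_RInt_minus f (fun _ => v) a b); [exact HI|].
  apply (is_RInt_const a b v).
Qed.

Lemma is_RInt_translate {V : CompleteNormedModule R_AbsRing} (f : R -> V) (c a b : R) (I : V) :
  is_RInt f (c + a) (c + b) I -> is_RInt (fun s => f (c + s)) a b I.
Proof.
  intros HI.
  apply is_RInt_ext with (f := fun y => scal 1 (f (1 * y + c))).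
  - intros s _. replace (1 * s + c) with (c + s) by ring. apply (scal_one (f (c + s))).
  - apply (is_RInt_comp_lin f 1 c a b).
    now replace (1 * a + c) with (c + a) by ring; replace (1 * b + c) with (c + b) by ring.
Qed.

Lemma is_RInt_fun_unique {V : CompleteNormedModule R_AbsRing} (f : R -> V) a b (I J : V) :
  is_RInt f a b I -> is_RInt f a b J -> I = J.
Proof.
  intros HI HJ. rewrite <- (is_RInt_unique f a b I HI). now apply is_RInt_unique.
Qed.

(** * Growth of functions controlled by their right Dini derivative *)

(** With slope [e > 0] allowed instead of 0, the set of [s] such that
    [p r <= p 0 + e * r] up to [s] is closed by left continuity and can be
    prolonged by the hypothesis on the right, so its supremum is [a]. *)
Lemma dini_nonincreasing (p : R -> R) (a : R) :
  0 <= a ->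
  (forall s, 0 < s <= a -> forall e, 0 < e -> exists d, 0 < d /\
     forall r, 0 <= r < s -> s - d < r -> Rabs (p r - p s) < e) ->
  (forall s, 0 <= s < a -> forall e, 0 < e -> exists d, 0 < d /\
     forall h, 0 < h < d -> p (s + h) <= p s + e * h) ->
  p a <= p 0.
Proof.
  intros Ha Hleft Hright. apply le_epsilon. intros e0 He0.
  set (e := e0 / (a + 1)).
  assert (He : 0 < e) by (apply Rdiv_lt_0_compat; lra).
  assert (Hea : e * a <= e0).
  { unfold e. apply Rmult_le_reg_r with (a + 1); [lra|].
    replace (e0 / (a + 1) * a * (a + 1)) with (e0 * a) by (field; lra). nra. }
  set (E := fun s => 0 <= s <= a /\ forall r, 0 <= r <= s -> p r <= p 0 + e * r).
  assert (E0 : E 0).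
  { split; [lra|]. intros r Hr. replace r with 0 by lra. lra. }
  destruct (completeness E) as [s [Hub Hlub]].
  { exists a. intros s [Hs _]. lra. }
  { now exists 0. }
  assert (Hs0 : 0 <= s) by now apply Hub.
  assert (Hsa : s <= a) by (apply Hlub; intros r [Hr _]; lra).
  assert (Hbelow : forall r, 0 <= r < s -> p r <= p 0 + e * r).
  { intros r Hr. apply Rnot_lt_le. intros Hn.
    assert (s <= r); [|lra]. apply Hlub. intros q [Hq Hq'].
    apply Rnot_lt_le. intros Hrq. specialize (Hq' r). lra. }
  assert (Hats : p s <= p 0 + e * s).
  { destruct (Req_dec s 0) as [->|Hs]; [lra|].
    apply le_epsilon. intros e1 He1.
    destruct (Hleft s ltac:(lra) e1 He1) as (d & Hd & H).
    set (r := Rmax 0 (s - d / 2)).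
    assert (Hr : 0 <= r < s /\ s - d < r).
    { unfold r, Rmax. destruct (Rle_dec 0 (s - d / 2)); lra. }
    specialize (H r (proj1 Hr) (proj2 Hr)). specialize (Hbelow r (proj1 Hr)).
    apply Rabs_def2 in H. nra. }
  assert (HE : E s).
  { split; [lra|]. intros r Hr. destruct (Req_dec r s) as [->|Hrs]; [exact Hats|].
    apply Hbelow; lra. }
  destruct (Req_dec s a) as [Heq|Hne]; [subst s; lra|].
  exfalso. destruct (Hright s ltac:(lra) e He) as (d & Hd & H).
  set (h := Rmin (d / 2) (a - s)).
  assert (Hh : 0 < h /\ h < d /\ h <= a - s).
  { unfold h, Rmin. destruct (Rle_dec (d / 2) (a - s)); lra. }
  assert (s + h <= s); [|lra].
  apply Hub. split; [lra|]. intros r Hr.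
  destruct (Rle_dec r s) as [Hrs|Hrs]; [apply HE; lra|].
  specialize (H (r - s) ltac:(lra)). replace (s + (r - s)) with r in H by ring. nra.
Qed.

(** * Uniform boundedness *)

Section UniformBoundedness.

Context {V : CompleteNormedModule R_AbsRing} {W : CompleteNormedModule R_AbsRing}.

(** Half of each radius bounds the next one, so the centres form a Cauchy
    sequence; the hypothesis on the centres says that the balls are nested. *)
Lemma nested_balls (x : nat -> V) (r : nat -> R) :
  (forall n, 0 < r (S n) <= r n / 2) ->
  (forall n, norm (minus (x (S n)) (x n)) <= r n - r (S n)) ->
  exists l, forall n, norm (minus l (x n)) <= r n.
Proof.
  intros Hr Hx.
  assert (Hd : forall n k, norm (minus (x (n + k)%nat) (x n)) <= r n - r (n + k)%nat).
  { intros n k. induction k as [|k IH].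
    - rewrite Nat.add_0_r, (norm_minus_self (x n)). lra.
    - rewrite Nat.add_succ_r. specialize (Hx (n + k)%nat).
      pose proof (norm_minus_triangle (x (S (n + k))) (x (n + k)%nat) (x n)). lra. }
  assert (Hpos : forall n, 0 < r n) by (intros n; specialize (Hr n); lra).
  assert (Hpow : forall n, r n <= r O * (/ 2) ^ n).
  { induction n as [|n IH]; [simpl; lra|]. specialize (Hr n). simpl. lra. }
  assert (Hsmall : forall e, 0 < e -> exists n, forall m, (n <= m)%nat -> r m < e).
  { intros e He.
    destruct (pow_lt_1_zero (/ 2)) with (y := e / r O) as [n Hn].
    - rewrite Rabs_right; lra.
    - apply Rdiv_lt_0_compat; [exact He|apply Hpos].
    - exists n. intros m Hm. specialize (Hn m Hm).
      rewrite Rabs_right in Hn by (left; apply pow_lt; lra).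
      eapply Rle_lt_trans; [apply Hpow|]. specialize (Hpos O).
      apply Rmult_lt_compat_l with (r := r O) in Hn; [|exact Hpos].
      replace (r O * (e / r O)) with e in Hn by (field; lra). exact Hn. }
  destruct (cauchy_sequence_converges x) as [l Hl].
  - intros e He. destruct (Hsmall (e / 2)) as [n Hn]; [lra|].
    exists n. intros m p Hm Hp.
    pose proof (norm_minus_triangle (x m) (x n) (x p)) as Ht.
    rewrite (norm_minus_sym (x n) (x p)) in Ht.
    pose proof (Hd n (m - n)%nat) as H1. pose proof (Hd n (p - n)%nat) as H2.
    replace (n + (m - n))%nat with m in H1 by lia.
    replace (n + (p - n))%nat with p in H2 by lia.
    pose proof (Hpos m). pose proof (Hpos p). specialize (Hn n (le_n n)). lra.
  - exists l. intros n. apply le_epsilon. intros e He.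
    destruct (Hl e He) as [k Hk]. specialize (Hk (n + k)%nat ltac:(lia)).
    rewrite norm_minus_sym in Hk.
    pose proof (norm_minus_triangle l (x (n + k)%nat) (x n)).
    pose proof (Hd n k). pose proof (Hpos (n + k)%nat). lra.
Qed.

(** If no uniform bound exists, every ball contains a smaller ball on which
    some [L n] exceeds a prescribed level: move the centre by [y] or [- y],
    where [L n y] is large, since [2 y] is the difference of the two candidates. *)
Lemma unbounded_family_ball (L : nat -> V -> W) :
  (forall n, is_linear (L n)) ->
  ~ (exists C, forall n x, norm (L n x) <= C * norm x) ->
  forall (x : V) (r C : R), 0 < r -> exists (x' : V) (r' : R),
    0 < r' <= r / 2 /\ norm (minus x' x) <= r - r' /\
    exists n, forall z, norm (minus z x') <= r' -> C <= norm (L n z).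
Proof.
  intros Hlin Hunb x r C0 Hr.
  set (C := Rmax C0 0).
  assert (HC : C0 <= C /\ 0 <= C) by (split; [apply Rmax_l|apply Rmax_r]).
  assert (exists n y, norm y = r / 2 /\ C + 1 <= norm (L n y)) as (n & y & Hy & HLy).
  { apply NNPP. intros Hn. apply Hunb. exists ((C + 1) / (r / 2)).
    intros n y. apply Rnot_lt_le. intros Hlt.
    assert (Hy : 0 < norm y).
    { destruct (norm_nonneg y) as [H|H]; [exact H|exfalso].
      symmetry in H. apply norm_zero_inv in H. subst y.
      rewrite (lin_zero (Hlin n)), !norm_of_zero in Hlt. lra. }
    apply Hn. exists n, (scal (r / 2 / norm y) y).
    assert (Hq : 0 < r / 2 / norm y) by (apply Rdiv_lt_0_compat; lra).
    rewrite (lin_scal (Hlin n)), !norm_scal_eq, !Rabs_right by lra.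
    split; [field; lra|].
    left. apply Rmult_lt_compat_l with (r := r / 2 / norm y) in Hlt; [|lra].
    replace (r / 2 / norm y * ((C + 1) / (r / 2) * norm y)) with (C + 1) in Hlt
      by (field; lra).
    exact Hlt. }
  destruct (linear_norm _ (Hlin n)) as (M & HM & HMb).
  exists (if Rle_dec (norm (L n y)) (norm (L n (plus x y))) then plus x y else minus x y).
  exists (Rmin (r / 2) (/ M)).
  assert (Hr' : 0 < Rmin (r / 2) (/ M) /\ Rmin (r / 2) (/ M) <= r / 2
                /\ Rmin (r / 2) (/ M) <= / M).
  { repeat split; [|apply Rmin_l|apply Rmin_r].
    apply Rmin_pos; [lra|now apply Rinv_0_lt_compat]. }
  assert (Hbig : forall w, norm (L n y) <= norm (L n w) -> forall z,
             norm (minus z w) <= Rmin (r / 2) (/ M) -> C0 <= norm (L n z)).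
  { intros w Hw z Hz.
    pose proof (norm_le_minus (L n w) (L n z)) as H1.
    rewrite norm_minus_sym in H1.
    assert (H2 : norm (minus (L n z) (L n w)) <= 1).
    { rewrite <- (lin_minus (Hlin n)). eapply Rle_trans; [apply HMb|].
      apply Rmult_le_reg_l with (/ M); [now apply Rinv_0_lt_compat|].
      replace (/ M * (M * norm (minus z w))) with (norm (minus z w)) by (field; lra).
      lra. }
    lra. }
  destruct (Rle_dec (norm (L n y)) (norm (L n (plus x y)))) as [Hle|Hgt].
  - split; [lra|]. split; [|exists n; now apply Hbig].
    replace (minus (plus x y) x) with y by linear_module. lra.
  - split; [lra|]. split; [|exists n; apply Hbig].
    + rewrite norm_minus_sym.
      replace (minus x (minus x y)) with y by linear_module. lra.
    + pose proof (norm_minus_le (L n (plus x y)) (L n (minus x y))) as H.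
      replace (minus (L n (plus x y)) (L n (minus x y)))
        with (scal 2 (L n y)) in H.
      * rewrite norm_scal_pos in H by lra. lra.
      * rewrite (lin_minus (Hlin n)), (lin_plus (Hlin n)). linear_module.
Qed.

(** Otherwise nested balls on which ever larger lower bounds hold would have a
    common point, at which the family is unbounded. *)
Lemma uniform_boundedness (L : nat -> V -> W) :
  (forall n, is_linear (L n)) ->
  (forall x, exists C, forall n, norm (L n x) <= C) ->
  exists C, forall n x, norm (L n x) <= C * norm x.
Proof.
  intros Hlin Hpt. apply NNPP. intros Hunb.
  pose proof (unbounded_family_ball L Hlin Hunb) as Hstep.
  assert (Hnext : forall (k : nat) (b : {b : V * R | 0 < snd b}),
             exists b' : {b : V * R | 0 < snd b},
               snd (proj1_sig b') <= snd (proj1_sig b) / 2 /\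
               norm (minus (fst (proj1_sig b')) (fst (proj1_sig b)))
               <= snd (proj1_sig b) - snd (proj1_sig b') /\
               exists n, forall z,
                 norm (minus z (fst (proj1_sig b'))) <= snd (proj1_sig b') ->
                 INR k <= norm (L n z)).
  { intros k [[x r] Hr]. simpl in Hr.
    destruct (Hstep x r (INR k) Hr) as (x' & r' & Hr' & Hx' & HL).
    exists (exist (fun b : V * R => 0 < snd b) (x', r') (proj1 Hr')). simpl.
    repeat split; [lra|exact Hx'|exact HL]. }
  pose (next := fun k b => proj1_sig (constructive_indefinite_description _ (Hnext k b))).
  pose (ball0 := exist (fun b : V * R => 0 < snd b) (@zero V, 1) Rlt_0_1).
  pose (balls := fix balls k := match k with O => ball0 | S k => next k (balls k) end).
  pose (xs := fun k => fst (proj1_sig (balls k))).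
  pose (rs := fun k => snd (proj1_sig (balls k))).
  assert (Hspec : forall k, 0 < rs (S k) <= rs k / 2 /\
             norm (minus (xs (S k)) (xs k)) <= rs k - rs (S k) /\
             exists n, forall z, norm (minus z (xs (S k))) <= rs (S k) ->
               INR k <= norm (L n z)).
  { intros k. unfold xs, rs. simpl. unfold next.
    destruct (constructive_indefinite_description _ (Hnext k (balls k))) as [[b Hb] H].
    simpl in *. tauto. }
  destruct (nested_balls xs rs) as [l Hl].
  { intros n. apply Hspec. }
  { intros n. apply Hspec. }
  destruct (Hpt l) as [C HC].
  destruct (nfloor_ex (Rmax C 0)) as [k Hk]; [apply Rmax_r|].
  destruct (Hspec (S k)) as (_ & _ & n & Hn).
  specialize (Hn l (Hl (S (S k)))). specialize (HC n).
  rewrite S_INR in Hn. pose proof (Rmax_l C 0). lra.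
Qed.

End UniformBoundedness.

(** * Strongly continuous semigroups *)

Record semigroup {V : CompleteNormedModule R_AbsRing} (T : R -> V -> V) : Prop := {
  semigroup_linear : forall t, 0 <= t -> is_linear (T t);
  semigroup_zero : forall x, T 0 x = x;
  semigroup_add : forall s t x, 0 <= s -> 0 <= t -> T (s + t) x = T s (T t x);
  semigroup_right_continuous : forall x e, 0 < e -> exists d, 0 < d /\
    forall h, 0 < h < d -> norm (minus (T h x) x) < e
}.

(** [y] lies in the domain of the generator of [T], which takes the value [z]
    there; the estimate avoids division by [h]. *)
Definition generator_value {V : CompleteNormedModule R_AbsRing}
    (T : R -> V -> V) (y z : V) : Prop :=
  forall e, 0 < e -> exists d, 0 < d /\ forall h, 0 < h < d ->
    norm (minus (minus (T h y) y) (scal h z)) <= e * h.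

Lemma generator_value_quotient {V : CompleteNormedModule R_AbsRing}
    (T : R -> V -> V) (y z : V) :
  generator_value T y z <->
  forall e, 0 < e -> exists d, 0 < d /\ forall h, 0 < h < d ->
    norm (minus (scal (/ h) (minus (T h y) y)) z) < e.
Proof.
  assert (Heq : forall h, 0 < h ->
    norm (minus (minus (T h y) y) (scal h z))
    = h * norm (minus (scal (/ h) (minus (T h y) y)) z)).
  { intros h Hh. rewrite <- norm_scal_pos by lra.
    f_equal. assert (h <> 0) by lra. linear_module. }
  split; intros H e He.
  - destruct (H (e / 2)) as (d & Hd & Hh); [lra|].
    exists d. split; [exact Hd|]. intros h Hhd. specialize (Hh h Hhd).
    rewrite Heq in Hh by lra.
    apply Rle_lt_trans with (e / 2); [|lra].
    apply Rmult_le_reg_l with h; [lra|]. rewrite (Rmult_comm h (e / 2)). exact Hh.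
  - destruct (H e He) as (d & Hd & Hh).
    exists d. split; [exact Hd|]. intros h Hhd. specialize (Hh h Hhd).
    rewrite Heq by lra. rewrite Rmult_comm. apply Rmult_le_compat_r; lra.
Qed.

Section SemigroupFacts.

Context {V : CompleteNormedModule R_AbsRing} {T : R -> V -> V}.
Hypothesis HT : semigroup T.

(** If no bound held near 0, there would be times [t n] tending to 0 along which
    the operators are unbounded in norm, although they converge pointwise. *)
Lemma semigroup_bounded_near_zero :
  exists d M, 0 < d /\ forall t x, 0 <= t <= d -> norm (T t x) <= M * norm x.
Proof.
  apply NNPP. intros Hn.
  assert (Hbad : forall n, exists t, 0 <= t <= / (INR n + 1) /\
             exists x, (INR n + 1) * norm x < norm (T t x)).
  { intros n. apply NNPP. intros Hm. apply Hn.
    exists (/ (INR n + 1)), (INR n + 1).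
    split; [apply Rinv_0_lt_compat; pose proof (pos_INR n); lra|].
    intros t x Ht. apply Rnot_lt_le. intros Hlt. apply Hm.
    exists t. split; [exact Ht|]. now exists x. }
  pose (t := fun n => proj1_sig (constructive_indefinite_description _ (Hbad n))).
  assert (Ht : forall n, 0 <= t n <= / (INR n + 1) /\
             exists x, (INR n + 1) * norm x < norm (T (t n) x)).
  { intros n. exact (proj2_sig (constructive_indefinite_description _ (Hbad n))). }
  destruct (uniform_boundedness (fun n => T (t n))) as [C HC].
  - intros n. apply (semigroup_linear T HT), Ht.
  - intros x. destruct (semigroup_right_continuous T HT x 1) as (d & Hd & Hx); [lra|].
    destruct (nfloor_ex (/ d)) as [N HN]; [left; now apply Rinv_0_lt_compat|].
    assert (Htail : forall n, (N < n)%nat -> norm (T (t n) x) <= norm x + 1).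
    { intros n Hnn. destruct (Ht n) as [[[H0|H0] H1] _].
      - assert (t n < d).
        { eapply Rle_lt_trans; [exact H1|]. rewrite <- (Rinv_inv d).
          apply Rinv_lt_contravar.
          - apply Rmult_lt_0_compat; [now apply Rinv_0_lt_compat|].
            pose proof (pos_INR n); lra.
          - apply lt_INR in Hnn. lra. }
        pose proof (Hx (t n) ltac:(lra)). pose proof (norm_le_minus (T (t n) x) x). lra.
      - rewrite <- H0, (semigroup_zero T HT). lra. }
    assert (Hhead : forall k, exists C, forall n, (n < k)%nat -> norm (T (t n) x) <= C).
    { induction k as [|k [C HC]]; [exists 0; intros; lia|].
      exists (Rmax C (norm (T (t k) x))). intros n Hnk.
      destruct (Nat.eq_dec n k) as [->|Hne]; [apply Rmax_r|].
      eapply Rle_trans; [apply HC; lia|apply Rmax_l]. }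
    destruct (Hhead (S N)) as [C HC]. exists (Rmax C (norm x + 1)). intros n.
    destruct (le_lt_dec n N) as [Hle|Hlt].
    + eapply Rle_trans; [apply HC; lia|apply Rmax_l].
    + eapply Rle_trans; [now apply Htail|apply Rmax_r].
  - destruct (nfloor_ex (Rmax C 0)) as [n Hnn]; [apply Rmax_r|].
    destruct (Ht n) as [_ [x Hx]]. specialize (HC n x).
    pose proof (Rmax_l C 0). pose proof (norm_nonneg x). nra.
Qed.

Lemma semigroup_bounded (a : R) :
  exists M, 1 <= M /\ forall t x, 0 <= t <= a -> norm (T t x) <= M * norm x.
Proof.
  destruct semigroup_bounded_near_zero as (d & M0 & Hd & HM0).
  set (M := Rmax M0 1).
  assert (HM : 1 <= M) by apply Rmax_r.
  assert (HMd : forall t x, 0 <= t <= d -> norm (T t x) <= M * norm x).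
  { intros t x Ht. eapply Rle_trans; [now apply HM0|].
    apply Rmult_le_compat_r; [apply norm_nonneg|apply Rmax_l]. }
  assert (Hpow : forall n, 1 <= M ^ n) by (intros n; now apply pow_R1_Rle).
  assert (Hn : forall n t x, 0 <= t <= INR n * d -> norm (T t x) <= M ^ n * norm x).
  { induction n as [|n IH]; intros t x Ht.
    - simpl in Ht. replace t with 0 by lra. rewrite (semigroup_zero T HT). simpl. lra.
    - rewrite S_INR in Ht. specialize (Hpow n). pose proof (norm_nonneg x).
      destruct (Rle_dec t d) as [Htd|Htd].
      + eapply Rle_trans; [apply HMd; lra|]. simpl.
        apply Rmult_le_compat_r; nra.
      + replace t with (d + (t - d)) by ring.
        rewrite (semigroup_add T HT) by lra.
        eapply Rle_trans; [apply HMd; lra|].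
        specialize (IH (t - d) x ltac:(lra)). simpl. nra. }
  destruct (nfloor_ex (Rmax (a / d) 0)) as [n Hnn]; [apply Rmax_r|].
  exists (M ^ S n). split; [apply Hpow|]. intros t x Ht. apply Hn.
  rewrite S_INR. pose proof (Rmax_l (a / d) 0).
  replace a with (a / d * d) in Ht by (field; lra). nra.
Qed.

Lemma semigroup_minus (t : R) (x y : V) :
  0 <= t -> T t (minus x y) = minus (T t x) (T t y).
Proof. intros Ht. apply lin_minus. now apply (semigroup_linear T HT). Qed.

Lemma semigroup_plus (t : R) (x y : V) :
  0 <= t -> T t (plus x y) = plus (T t x) (T t y).
Proof. intros Ht. apply lin_plus. now apply (semigroup_linear T HT). Qed.

Lemma semigroup_scal (t r : R) (x : V) :
  0 <= t -> T t (scal r x) = scal r (T t x).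
Proof. intros Ht. apply lin_scal. now apply (semigroup_linear T HT). Qed.

Lemma semigroup_orbit_continuous (x : V) : continuous_nonneg (fun t => T t x).
Proof.
  intros s Hs e He. destruct (semigroup_bounded (s + 1)) as (M & HM & HMb).
  destruct (semigroup_right_continuous T HT x (e / M)) as (d & Hd & Hx).
  { apply Rdiv_lt_0_compat; lra. }
  assert (Hinc : forall p q, 0 <= p <= s + 1 -> 0 < q < d ->
             norm (minus (T (p + q) x) (T p x)) < e).
  { intros p q Hp Hq. rewrite (semigroup_add T HT), <- semigroup_minus by lra.
    eapply Rle_lt_trans; [apply HMb; lra|].
    specialize (Hx q Hq). apply Rmult_lt_compat_l with (r := M) in Hx; [|lra].
    replace (M * (e / M)) with e in Hx by (field; lra). exact Hx. }
  exists (Rmin d 1); split; [apply Rmin_pos; lra|]. intros r Hr Hrs.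
  pose proof (Rmin_l d 1). pose proof (Rmin_r d 1).
  apply Rabs_def2 in Hrs.
  destruct (Rtotal_order r s) as [H1|[->|H1]].
  - rewrite norm_minus_sym. replace s with (r + (s - r)) by ring. apply Hinc; lra.
  - now rewrite norm_minus_self.
  - replace r with (s + (r - s)) by ring. apply Hinc; lra.
Qed.

Lemma generator_value_orbit (s : R) (y z : V) :
  0 <= s -> generator_value T y z -> generator_value T (T s y) (T s z).
Proof.
  intros Hs Hy e He. destruct (semigroup_bounded s) as (M & HM & HMb).
  destruct (Hy (e / M)) as (d & Hd & H); [apply Rdiv_lt_0_compat; lra|].
  exists d; split; [exact Hd|]. intros h Hh. specialize (H h Hh).
  replace (T h (T s y)) with (T s (T h y))
    by (rewrite <- !(semigroup_add T HT) by lra; f_equal; ring).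
  rewrite <- semigroup_scal, <- !semigroup_minus by lra.
  eapply Rle_trans; [apply HMb; lra|].
  apply Rmult_le_compat_l with (r := M) in H; [|lra].
  replace (M * (e / M * h)) with (e * h) in H by (field; lra). exact H.
Qed.

(** ** Integrals of orbits *)

Definition orbit_integral (a b : R) (x : V) : V := RInt (fun s => T s x) a b.

Lemma orbit_integral_spec (a b : R) (x : V) :
  0 <= a -> 0 <= b -> is_RInt (fun s => T s x) a b (orbit_integral a b x).
Proof.
  intros Ha Hb. apply (RInt_correct (fun s => T s x) a b).
  apply ex_RInt_ext with (f := fun s => T (Rabs s) x).
  - intros s Hs. rewrite Rabs_right; [reflexivity|].
    assert (0 <= Rmin a b) by now apply Rmin_glb. lra.
  - apply (ex_RInt_continuous (fun s => T (Rabs s) x)). intros s _.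
    exact (continuous_nonneg_Rabs _ (semigroup_orbit_continuous x) s).
Qed.

Lemma orbit_integral_unique (a b : R) (x I : V) :
  is_RInt (fun s => T s x) a b I -> orbit_integral a b x = I.
Proof. apply (is_RInt_unique (fun s => T s x) a b I). Qed.

Lemma orbit_integral_bound (a b M : R) (x : V) :
  0 <= a <= b -> (forall t, 0 <= t <= b -> norm (T t x) <= M * norm x) ->
  norm (orbit_integral a b x) <= (b - a) * (M * norm x).
Proof.
  intros Hab HM.
  apply (norm_RInt_le_const (fun s => T s x) a b); [lra| |].
  - intros s Hs. apply HM. lra.
  - apply orbit_integral_spec; lra.
Qed.

Lemma orbit_integral_linear (h : R) : 0 <= h -> is_linear (orbit_integral 0 h).
Proof.
  intros Hh. split.
  - intros x y. apply orbit_integral_unique.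
    apply is_RInt_ext with (f := fun s => plus (T s x) (T s y)).
    + intros s Hs. rewrite Rmin_left in Hs by lra.
      symmetry. apply semigroup_plus. lra.
    + apply (is_RInt_plus (fun s => T s x) (fun s => T s y));
        apply orbit_integral_spec; lra.
  - intros r x. apply orbit_integral_unique.
    apply is_RInt_ext with (f := fun s => scal r (T s x)).
    + intros s Hs. rewrite Rmin_left in Hs by lra.
      symmetry. apply semigroup_scal. lra.
    + apply (is_RInt_scal (fun s => T s x)). apply orbit_integral_spec; lra.
  - destruct (semigroup_bounded h) as (M & HM & HMb).
    exists (h * M + 1). split; [nra|]. intros x.
    pose proof (orbit_integral_bound 0 h M x ltac:(lra) (fun t => HMb t x)) as H.
    pose proof (norm_nonneg x).
    change (norm (orbit_integral 0 h x) <= (h * M + 1) * norm x). nra.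
Qed.

Lemma orbit_integral_shift (t h : R) (x : V) :
  0 <= t -> 0 <= h ->
  orbit_integral 0 h (T t x) = orbit_integral t (t + h) x.
Proof.
  intros Ht Hh. apply orbit_integral_unique.
  apply is_RInt_ext with (f := fun s => T (t + s) x).
  - intros s Hs. rewrite Rmin_left in Hs by lra.
    rewrite Rplus_comm. apply (semigroup_add T HT); lra.
  - apply (is_RInt_translate (fun s => T s x)). rewrite Rplus_0_r.
    apply orbit_integral_spec; lra.
Qed.

Lemma orbit_integral_commute (t h : R) (x : V) :
  0 <= t -> 0 <= h ->
  T t (orbit_integral 0 h x) = orbit_integral 0 h (T t x).
Proof.
  intros Ht Hh. symmetry. apply orbit_integral_unique.
  apply is_RInt_ext with (f := fun s => T t (T s x)).
  - intros s Hs. rewrite Rmin_left in Hs by lra.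
    rewrite <- !(semigroup_add T HT) by lra. f_equal. ring.
  - apply (is_RInt_linear (T t) (fun s => T s x)).
    + now apply (semigroup_linear T HT).
    + apply orbit_integral_spec; lra.
Qed.

(** Both sides are the integral over [0, t + h] minus that over [0, t]. *)
Lemma orbit_integral_increment (t h : R) (x : V) :
  0 <= t -> 0 <= h ->
  orbit_integral 0 h (T t x)
  = plus (orbit_integral 0 h x)
      (minus (orbit_integral h (h + t) x) (orbit_integral 0 t x)).
Proof.
  intros Ht Hh. rewrite orbit_integral_shift by assumption.
  assert (H : plus (orbit_integral 0 t x) (orbit_integral t (t + h) x)
              = plus (orbit_integral 0 h x) (orbit_integral h (h + t) x)).
  { apply (is_RInt_fun_unique (fun s => T s x) 0 (t + h)).
    - apply (is_RInt_Chasles (fun s => T s x) 0 t); apply orbit_integral_spec; lra.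
    - rewrite (Rplus_comm t h).
      apply (is_RInt_Chasles (fun s => T s x) 0 h); apply orbit_integral_spec; lra. }
  transitivity (minus (plus (orbit_integral 0 t x) (orbit_integral t (t + h) x))
                  (orbit_integral 0 t x)); [linear_module|].
  rewrite H. linear_module.
Qed.

Lemma orbit_integral_mean (a : R) (x : V) (e : R) :
  0 <= a -> 0 < e -> exists d, 0 < d /\ forall b, a < b < a + d ->
    norm (minus (orbit_integral a b x) (scal (b - a) (T a x))) <= (b - a) * e.
Proof.
  intros Ha He.
  destruct (semigroup_orbit_continuous x a Ha e He) as (d & Hd & H).
  exists d; split; [exact Hd|]. intros b Hb.
  apply (is_RInt_near_const (fun s => T s x)); [lra| |].
  - apply orbit_integral_spec; lra.
  - intros s Hs. left. apply H; [lra|]. apply Rabs_def1; lra.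
Qed.

(** The means of an orbit over short intervals are in the domain, as their
    increments under [T t] are differences of integrals over intervals of length [t]. *)
Lemma generator_domain_dense (x : V) (e : R) :
  0 < e -> exists y z, generator_value T y z /\ norm (minus x y) <= e.
Proof.
  intros He.
  destruct (orbit_integral_mean 0 x e) as (d & Hd & Hmean); [lra|exact He|].
  set (h := d / 2). assert (Hh : 0 < h) by (unfold h; lra).
  exists (scal (/ h) (orbit_integral 0 h x)), (scal (/ h) (minus (T h x) x)).
  assert (Hh0 : h <> 0) by lra.
  assert (Hih : 0 < / h) by now apply Rinv_0_lt_compat.
  split.
  - intros e1 He1.
    destruct (orbit_integral_mean h x (h * e1 / 2)) as (d1 & Hd1 & H1); [lra|nra|].
    destruct (orbit_integral_mean 0 x (h * e1 / 2)) as (d2 & Hd2 & H2); [lra|nra|].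
    exists (Rmin d1 d2). split; [now apply Rmin_pos|]. intros t Ht.
    pose proof (Rmin_l d1 d2). pose proof (Rmin_r d1 d2).
    specialize (H1 (h + t) ltac:(lra)). specialize (H2 t ltac:(lra)).
    rewrite (semigroup_zero T HT) in H2.
    replace (h + t - h) with t in H1 by ring. rewrite Rminus_0_r in H2.
    rewrite semigroup_scal, orbit_integral_commute, orbit_integral_increment by lra.
    match goal with |- norm ?u <= _ => replace u
      with (scal (/ h) (minus (minus (orbit_integral h (h + t) x) (scal t (T h x)))
                  (minus (orbit_integral 0 t x) (scal t x)))) by linear_module end.
    rewrite norm_scal_pos by lra.
    match goal with |- _ * norm (minus ?u ?v) <= _ =>
      pose proof (norm_minus_le u v) as H3 end.
    apply Rmult_le_reg_l with h; [exact Hh|].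
    rewrite <- Rmult_assoc, Rinv_r, Rmult_1_l by lra. nra.
  - specialize (Hmean h ltac:(unfold h; lra)).
    rewrite (semigroup_zero T HT), Rminus_0_r in Hmean.
    replace (minus x (scal (/ h) (orbit_integral 0 h x)))
      with (scal (- / h) (minus (orbit_integral 0 h x) (scal h x))) by linear_module.
    rewrite norm_scal_eq, Rabs_Ropp, Rabs_right by lra.
    apply Rmult_le_reg_l with h; [exact Hh|].
    rewrite <- Rmult_assoc, Rinv_r, Rmult_1_l by lra. exact Hmean.
Qed.

End SemigroupFacts.

(** * Bounded perturbation of the generator *)

(** Mean value inequality for a right derivative. *)
Lemma norm_increment_le {V : CompleteNormedModule R_AbsRing} (q : R -> V) (a c : R) :
  0 <= a ->
  (forall s, 0 < s <= a -> forall e, 0 < e -> exists d, 0 < d /\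
     forall r, 0 <= r < s -> s - d < r -> norm (minus (q r) (q s)) < e) ->
  (forall s, 0 <= s < a -> forall e, 0 < e -> exists d, 0 < d /\
     forall h, 0 < h < d -> norm (minus (q (s + h)) (q s)) <= (c + e) * h) ->
  norm (minus (q a) (q 0)) <= c * a.
Proof.
  intros Ha Hleft Hright.
  assert (H : norm (minus (q a) (q 0)) - c * a <= norm (minus (q 0) (q 0)) - c * 0);
    [|rewrite norm_minus_self in H; lra].
  apply (dini_nonincreasing (fun s => norm (minus (q s) (q 0)) - c * s) a Ha).
  - intros s Hs e He.
    destruct (Hleft s Hs (e / 2)) as (d & Hd & H); [lra|].
    assert (Hc : 0 < Rabs c + 1) by (pose proof (Rabs_pos c); lra).
    exists (Rmin d (e / 2 / (Rabs c + 1))).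
    split; [apply Rmin_pos; [exact Hd|apply Rdiv_lt_0_compat; lra]|].
    intros r Hr Hrs.
    pose proof (Rmin_l d (e / 2 / (Rabs c + 1))).
    pose proof (Rmin_r d (e / 2 / (Rabs c + 1))).
    specialize (H r Hr ltac:(lra)).
    pose proof (norm_minus_triangle (q r) (q s) (q 0)).
    pose proof (norm_minus_triangle (q s) (q r) (q 0)) as H4.
    rewrite (norm_minus_sym (q s) (q r)) in H4.
    assert (Hcr : Rabs (c * (s - r)) < e / 2).
    { rewrite Rabs_mult, (Rabs_right (s - r)) by lra.
      apply Rle_lt_trans with ((Rabs c + 1) * (s - r)).
      - apply Rmult_le_compat_r; lra.
      - apply Rlt_le_trans with ((Rabs c + 1) * (e / 2 / (Rabs c + 1))).
        + apply Rmult_lt_compat_l; lra.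
        + right. field. lra. }
    apply Rabs_def2 in Hcr. apply Rabs_def1; lra.
  - intros s Hs e He. destruct (Hright s Hs e He) as (d & Hd & H).
    exists d; split; [exact Hd|]. intros h Hh. specialize (H h Hh).
    pose proof (norm_minus_triangle (q (s + h)) (q s) (q 0)). nra.
Qed.

Section Perturbation.

Context {V : CompleteNormedModule R_AbsRing} {T S : R -> V -> V} {K : V -> V}.
Hypothesis HT : semigroup T.
Hypothesis HS : semigroup S.
Hypothesis HK : is_linear K.
Hypothesis HTS : forall y z, generator_value T y z -> generator_value S y (plus z (K y)).

(** On the domain the path from [S h y] to [T h y] through [S (h - s) (T s y)]
    has velocity [- S (h - s) (K (T s y))]. *)
Lemma semigroup_difference_domain :
  exists C, 0 <= C /\ forall y z h, generator_value T y z -> 0 <= h <= 1 ->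
    norm (minus (T h y) (S h y)) <= C * norm y * h.
Proof.
  destruct (semigroup_bounded HT 1) as (MT & HMT & HMTb).
  destruct (semigroup_bounded HS 1) as (MS & HMS & HMSb).
  destruct (linear_norm K HK) as (bK & HbK & HKb).
  exists (MS * bK * MT). split; [apply Rmult_le_pos; nra|]. intros y z a Hy Ha.
  pose proof (norm_nonneg y) as Hny.
  replace (minus (T a y) (S a y))
    with (minus (S (a - a) (T a y)) (S (a - 0) (T 0 y)))
    by (rewrite Rminus_diag, Rminus_0_r, (semigroup_zero S HS), (semigroup_zero T HT);
        reflexivity).
  apply (norm_increment_le (fun s => S (a - s) (T s y))); [lra| |].
  - intros s Hs e He.
    destruct (semigroup_orbit_continuous HT y s ltac:(lra) (e / 2 / MS)) as (d1 & Hd1 & H1).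
    { repeat apply Rdiv_lt_0_compat; lra. }
    destruct (semigroup_orbit_continuous HS (T s y) (a - s) ltac:(lra) (e / 2))
      as (d2 & Hd2 & H2); [lra|].
    exists (Rmin d1 d2). split; [now apply Rmin_pos|]. intros r Hr Hrs.
    pose proof (Rmin_l d1 d2). pose proof (Rmin_r d1 d2).
    specialize (H1 r ltac:(lra) ltac:(apply Rabs_def1; lra)).
    specialize (H2 (a - r) ltac:(lra) ltac:(apply Rabs_def1; lra)).
    pose proof (norm_minus_triangle (S (a - r) (T r y)) (S (a - r) (T s y))
                  (S (a - s) (T s y))) as Hd3.
    rewrite <- (semigroup_minus HS) in Hd3 by lra.
    pose proof (HMSb (a - r) (minus (T r y) (T s y)) ltac:(lra)).
    apply Rmult_lt_compat_l with (r := MS) in H1; [|lra].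
    replace (MS * (e / 2 / MS)) with (e / 2) in H1 by (field; lra). lra.
  - intros s Hs e He.
    pose proof (generator_value_orbit HT s y z ltac:(lra) Hy) as Hw.
    set (w := T s y) in *. set (z' := T s z) in *.
    set (e' := e / (2 * MS)).
    assert (He' : 0 < e') by (apply Rdiv_lt_0_compat; lra).
    destruct (Hw e' He') as (d1 & Hd1 & H1).
    destruct (HTS _ _ Hw e' He') as (d2 & Hd2 & H2).
    exists (Rmin (Rmin d1 d2) (a - s)).
    split; [repeat apply Rmin_pos; lra|]. intros h Hh.
    pose proof (Rmin_l (Rmin d1 d2) (a - s)). pose proof (Rmin_r (Rmin d1 d2) (a - s)).
    pose proof (Rmin_l d1 d2). pose proof (Rmin_r d1 d2).
    specialize (H1 h ltac:(lra)). specialize (H2 h ltac:(lra)).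
    replace (T (s + h) y) with (T h w)
      by (unfold w; rewrite <- (semigroup_add T HT) by lra; f_equal; ring).
    replace (S (a - s) w) with (S (a - (s + h)) (S h w))
      by (rewrite <- (semigroup_add S HS) by lra; f_equal; ring).
    rewrite <- (semigroup_minus HS) by lra.
    eapply Rle_trans; [apply HMSb; lra|].
    assert (Hd3 : norm (minus (T h w) (S h w)) <= 2 * e' * h + h * (bK * (MT * norm y))).
    { replace (minus (T h w) (S h w))
        with (minus (minus (minus (minus (T h w) w) (scal h z'))
                (minus (minus (S h w) w) (scal h (plus z' (K w))))) (scal h (K w)))
        by linear_module.
      eapply Rle_trans; [apply norm_minus_le|].
      match goal with |- norm (minus ?u ?v) + _ <= _ =>
        pose proof (norm_minus_le u v) end.
      rewrite norm_scal_pos by lra.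
      pose proof (HKb w). pose proof (HMTb s y ltac:(lra)) as Hd8. fold w in Hd8.
      assert (norm (K w) <= bK * (MT * norm y)).
      { eapply Rle_trans; [apply HKb|]. apply Rmult_le_compat_l; lra. }
      nra. }
    apply Rmult_le_compat_l with (r := MS) in Hd3; [|lra].
    replace (MS * (2 * e' * h + h * (bK * (MT * norm y))))
      with ((MS * bK * MT * norm y + e) * h) in Hd3 by (unfold e'; field; lra).
    exact Hd3.
Qed.

(** Both sides are continuous in [x], and the bound on the dense domain does not
    involve the values of the generators. *)
Lemma semigroup_difference_le :
  exists C, 0 <= C /\ forall x h, 0 <= h <= 1 ->
    norm (minus (T h x) (S h x)) <= C * norm x * h.
Proof.
  destruct semigroup_difference_domain as (C & HC & HCb).
  destruct (semigroup_bounded HT 1) as (MT & HMT & HMTb).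
  destruct (semigroup_bounded HS 1) as (MS & HMS & HMSb).
  exists C. split; [exact HC|]. intros x h Hh. apply le_epsilon. intros e He.
  set (e' := e / (C + MT + MS)).
  assert (He' : 0 < e') by (apply Rdiv_lt_0_compat; lra).
  destruct (generator_domain_dense HT x e' He') as (y & z & Hy & Hxy).
  specialize (HCb y z h Hy Hh).
  replace (minus (T h x) (S h x))
    with (plus (minus (T h y) (S h y)) (minus (T h (minus x y)) (S h (minus x y)))).
  2:{ rewrite (semigroup_minus HT), (semigroup_minus HS) by lra. linear_module. }
  eapply Rle_trans; [apply norm_plus_le|].
  pose proof (norm_minus_le (T h (minus x y)) (S h (minus x y))).
  pose proof (HMTb h (minus x y) Hh). pose proof (HMSb h (minus x y) Hh).
  pose proof (norm_le_minus y x) as Hd3. rewrite norm_minus_sym in Hd3.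
  assert (Hd4 : C * norm y * h <= C * norm x * h + C * e').
  { pose proof (Rmult_le_pos C e' HC ltac:(lra)).
    apply Rle_trans with (C * (norm x + e') * h); [|nra].
    apply Rmult_le_compat_r; [lra|]. apply Rmult_le_compat_l; lra. }
  assert (Hd5 : C * e' + (MT * e' + MS * e') = e) by (unfold e'; field; lra).
  assert (MT * norm (minus x y) <= MT * e') by (apply Rmult_le_compat_l; lra).
  assert (MS * norm (minus x y) <= MS * e') by (apply Rmult_le_compat_l; lra).
  lra.
Qed.

(** For [y] in the domain this is the difference of the two generators; the
    Lipschitz bound makes it pass to all vectors, so the two semigroups differ
    to first order by [K] even where neither of them is differentiable. *)
Lemma semigroup_difference_derivative (x : V) (e : R) :
  0 < e -> exists d, 0 < d /\ forall h, 0 < h < d ->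
    norm (plus (minus (T h x) (S h x)) (scal h (K x))) <= e * h.
Proof.
  intros He.
  destruct semigroup_difference_le as (C & HC & HCb).
  destruct (linear_norm K HK) as (bK & HbK & HKb).
  set (e' := e / (2 * (C + bK))).
  assert (He' : 0 < e') by (apply Rdiv_lt_0_compat; lra).
  destruct (generator_domain_dense HT x e' He') as (y & z & Hy & Hxy).
  destruct (Hy (e / 4)) as (d1 & Hd1 & H1); [lra|].
  destruct (HTS _ _ Hy (e / 4)) as (d2 & Hd2 & H2); [lra|].
  exists (Rmin (Rmin d1 d2) 1). split; [repeat apply Rmin_pos; lra|]. intros h Hh.
  pose proof (Rmin_l (Rmin d1 d2) 1). pose proof (Rmin_r (Rmin d1 d2) 1).
  pose proof (Rmin_l d1 d2). pose proof (Rmin_r d1 d2).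
  specialize (H1 h ltac:(lra)). specialize (H2 h ltac:(lra)).
  set (w := minus x y) in *.
  specialize (HCb w h ltac:(lra)).
  replace (plus (minus (T h x) (S h x)) (scal h (K x)))
    with (plus (minus (minus (minus (T h y) y) (scal h z))
                  (minus (minus (S h y) y) (scal h (plus z (K y)))))
               (plus (minus (T h w) (S h w)) (scal h (K w)))).
  2:{ unfold w. rewrite (semigroup_minus HT), (semigroup_minus HS), (lin_minus HK) by lra.
      linear_module. }
  assert (Hw : norm (plus (minus (T h w) (S h w)) (scal h (K w))) <= e / 2 * h).
  { eapply Rle_trans; [apply norm_plus_le|]. rewrite norm_scal_pos by lra.
    replace (e / 2 * h) with (C * e' * h + h * (bK * e')) by (unfold e'; field; lra).
    apply Rplus_le_compat.
    - eapply Rle_trans; [exact HCb|].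
      apply Rmult_le_compat_r; [lra|]. apply Rmult_le_compat_l; lra.
    - apply Rmult_le_compat_l; [lra|]. eapply Rle_trans; [apply HKb|].
      apply Rmult_le_compat_l; lra. }
  eapply Rle_trans; [apply norm_plus_le|].
  replace (e * h) with ((e / 4 * h + e / 4 * h) + e / 2 * h) by field.
  apply Rplus_le_compat; [|exact Hw].
  eapply Rle_trans; [apply norm_minus_le|]. apply Rplus_le_compat; [exact H1|exact H2].
Qed.

End Perturbation.

(** * Decay in a norm adapted to an exponentially stable semigroup *)

Lemma exp_nondecreasing (x y : R) : x <= y -> exp x <= exp y.
Proof. intros [H| ->]; [left; now apply exp_increasing|right; reflexivity]. Qed.

Section Decay.

Context {V : CompleteNormedModule R_AbsRing} {S : R -> V -> V} {Gam gam : R}.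
Hypothesis HS : semigroup S.
Hypothesis Hgam : 0 < gam.
Hypothesis Hdecay : forall t x, 0 <= t -> norm (S t x) <= Gam * exp (- gam * t) * norm x.

(** [N x] is the supremum of [exp (gam * t) * norm (S t x)] over [t >= 0]. In the
    original norm a bound with [Gam > 1] does not contract over short intervals,
    in this one [S h] contracts for every [h > 0]. *)
Lemma adapted_norm_exists :
  exists N : V -> R,
    (forall x, norm x <= N x <= Gam * norm x) /\
    (forall x y, N (plus x y) <= N x + N y) /\
    (forall h x, 0 <= h -> N (S h x) <= exp (- gam * h) * N x).
Proof.
  set (E := fun x r => exists t, 0 <= t /\ r = exp (gam * t) * norm (S t x)).
  assert (Hbound : forall x, is_upper_bound (E x) (Gam * norm x)).
  { intros x r (t & Ht & ->).
    apply Rmult_le_reg_l with (exp (- gam * t)); [apply exp_pos|].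
    rewrite <- Rmult_assoc, <- exp_plus.
    replace (- gam * t + gam * t) with 0 by ring. rewrite exp_0.
    specialize (Hdecay t x Ht). lra. }
  assert (Hin : forall x, E x (norm x)).
  { intros x. exists 0. split; [lra|].
    rewrite Rmult_0_r, exp_0, (semigroup_zero S HS). ring. }
  assert (Hlub : forall x, exists m, is_lub (E x) m).
  { intros x. destruct (completeness (E x)) as [m Hm]; [now eexists|now eexists|].
    now exists m. }
  pose (N := fun x => proj1_sig (constructive_indefinite_description _ (Hlub x))).
  assert (HN : forall x, is_lub (E x) (N x)).
  { intros x. exact (proj2_sig (constructive_indefinite_description _ (Hlub x))). }
  exists N. split; [|split].
  - intros x. split.
    + now apply (proj1 (HN x)).
    + now apply (proj2 (HN x)).
  - intros x y. apply (proj2 (HN (plus x y))). intros r (t & Ht & ->).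
    rewrite (semigroup_plus HS) by exact Ht.
    assert (Hx : exp (gam * t) * norm (S t x) <= N x) by (apply (HN x); now exists t).
    assert (Hy : exp (gam * t) * norm (S t y) <= N y) by (apply (HN y); now exists t).
    pose proof (norm_plus_le (S t x) (S t y)) as H.
    apply Rmult_le_compat_l with (r := exp (gam * t)) in H; [lra|left; apply exp_pos].
  - intros h x Hh. apply (proj2 (HN (S h x))). intros r (t & Ht & ->).
    rewrite <- (semigroup_add S HS) by assumption.
    assert (Hx : exp (gam * (t + h)) * norm (S (t + h) x) <= N x).
    { apply (HN x). exists (t + h). split; [lra|reflexivity]. }
    replace (gam * t) with (- gam * h + gam * (t + h)) by ring.
    rewrite exp_plus, Rmult_assoc.
    apply Rmult_le_compat_l; [left; apply exp_pos|exact Hx].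
Qed.

(** The first-order expansion says that [x] solves the equation generated by [S]
    with forcing term [g]. In the adapted norm [n s = N (x s)] then satisfies
    [n' <= - gam * n + Gam * G] in the sense of right Dini derivatives, hence
    [exp (gam * s) * (n s - Gam * G / gam)] does not increase. *)
Lemma adapted_norm_decay (N : V -> R) (x g : R -> V) (a G : R) :
  (forall x, norm x <= N x <= Gam * norm x) ->
  (forall x y, N (plus x y) <= N x + N y) ->
  (forall h x, 0 <= h -> N (S h x) <= exp (- gam * h) * N x) ->
  0 < Gam -> 0 <= a -> continuous_nonneg x ->
  (forall s, 0 <= s < a -> norm (g s) <= G) -> 0 <= G ->
  (forall s, 0 <= s < a -> forall e, 0 < e -> exists d, 0 < d /\ forall h, 0 < h < d ->
     norm (minus (minus (x (s + h)) (S h (x s))) (scal h (g s))) <= e * h) ->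
  N (x a) <= exp (- gam * a) * N (x 0) + Gam * G / gam * (1 - exp (- gam * a)).
Proof.
  intros HN1 HNplus HNS HGam Ha Hx Hg HG Hstep.
  set (c := Gam * G / gam).
  assert (Hc : 0 <= c) by (apply Rdiv_le_0_compat; [apply Rmult_le_pos; lra|lra]).
  assert (Hgc : Gam * G = gam * c) by (unfold c; field; lra).
  clearbody c.
  assert (HNlip : forall y z, Rabs (N y - N z) <= Gam * norm (minus y z)).
  { intros y z.
    pose proof (HNplus z (minus y z)) as H1. pose proof (HNplus y (minus z y)) as H2.
    replace (plus z (minus y z)) with y in H1 by linear_module.
    replace (plus y (minus z y)) with z in H2 by linear_module.
    pose proof (HN1 (minus y z)). pose proof (HN1 (minus z y)) as H3.
    rewrite (norm_minus_sym z y) in H3. apply Rabs_le. lra. }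
  set (p := fun s => exp (gam * s) * (N (x (Rabs s)) - c)).
  assert (Hp : p a <= p 0).
  { apply dini_nonincreasing; [exact Ha| |].
    - intros s Hs e He.
      assert (Hcont : continuity_pt p s).
      { apply continuity_pt_mult.
        - apply derivable_continuous_pt. reg.
        - apply continuity_pt_minus; [|apply continuity_pt_const; now intros ? ?].
          intros e1 He1.
          destruct (Hx (Rabs s) (Rabs_pos s) (e1 / Gam)) as (d & Hd & H);
            [apply Rdiv_lt_0_compat; lra|].
          exists d. split; [exact Hd|]. intros r [_ Hr].
          simpl in Hr |- *; unfold Rdist in *.
          eapply Rle_lt_trans; [apply HNlip|].
          specialize (H (Rabs r) (Rabs_pos r)
                        (Rle_lt_trans _ _ _ (Rabs_triang_inv2 r s) Hr)).
          apply Rmult_lt_compat_l with (r := Gam) in H; [|lra].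
          replace (Gam * (e1 / Gam)) with e1 in H by (field; lra). exact H. }
      destruct (Hcont e He) as (d & Hd & H). exists d. split; [exact Hd|].
      intros r Hr Hrs. apply H. split.
      + split; [exact I|]. lra.
      + simpl. unfold Rdist. apply Rabs_def1; lra.
    - intros s Hs e He.
      set (E := exp (gam * a)).
      assert (HE : 0 < E) by apply exp_pos.
      assert (HEs : 0 < exp (gam * s) <= E).
      { split; [apply exp_pos|]. apply exp_nondecreasing.
        apply Rmult_le_compat_l; lra. }
      set (e1 := e / (6 * Gam * E)).
      assert (He1 : 0 < e1).
      { apply Rdiv_lt_0_compat; [lra|]. repeat apply Rmult_lt_0_compat; lra. }
      destruct (Hstep s Hs e1 He1) as (d & Hd & H).
      set (d' := e / (2 * E * (c * gam * gam + 1))).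
      assert (Hcg : 0 <= c * gam * gam)
        by (repeat apply Rmult_le_pos; lra).
      assert (Hd' : 0 < d').
      { apply Rdiv_lt_0_compat; [lra|]. repeat apply Rmult_lt_0_compat; lra. }
      assert (Hig : 0 < / gam) by now apply Rinv_0_lt_compat.
      exists (Rmin d (Rmin (/ gam) d')). split; [repeat apply Rmin_pos; lra|].
      intros h Hh.
      pose proof (Rmin_l d (Rmin (/ gam) d')). pose proof (Rmin_r d (Rmin (/ gam) d')).
      pose proof (Rmin_l (/ gam) d'). pose proof (Rmin_r (/ gam) d').
      specialize (H h ltac:(lra)). specialize (Hg s Hs).
      assert (Hgh : 0 < gam * h < 1).
      { split; [apply Rmult_lt_0_compat; lra|].
        rewrite <- (Rinv_r gam) by lra. apply Rmult_lt_compat_l; lra. }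
      unfold p. rewrite !Rabs_right by lra.
      assert (Hn : N (x (s + h)) <= exp (- gam * h) * N (x s) + Gam * (G + e1) * h).
      { set (r := minus (minus (x (s + h)) (S h (x s))) (scal h (g s))) in *.
        replace (x (s + h)) with (plus (S h (x s)) (plus r (scal h (g s))))
          by (unfold r; linear_module).
        eapply Rle_trans; [apply HNplus|].
        apply Rplus_le_compat; [apply HNS; lra|].
        eapply Rle_trans; [apply HN1|]. rewrite Rmult_assoc.
        apply Rmult_le_compat_l; [lra|].
        eapply Rle_trans; [apply norm_plus_le|]. rewrite norm_scal_pos by lra.
        pose proof (norm_nonneg (g s)). nra. }
      replace (gam * (s + h)) with (gam * s + gam * h) by ring. rewrite exp_plus.
      set (Es := exp (gam * s)) in *. set (F := exp (gam * h)).
      assert (HF3 : F < 3).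
      { eapply Rlt_le_trans; [apply exp_increasing, Hgh|apply exp_le_3]. }
      assert (HF1 : 1 + gam * h <= F) by (left; apply exp_ineq1; lra).
      assert (HFinv : F * exp (- gam * h) = 1).
      { unfold F. rewrite <- exp_plus. replace (gam * h + - gam * h) with 0 by ring.
        apply exp_0. }
      (* First-order terms cancel: [F * (1 - gam * h)] is at least
         [(1 + gam * h) * (1 - gam * h)], which is 1 up to second order. *)
      assert (Hmain : F * (N (x (s + h)) - c) - (N (x s) - c)
                      <= c * gam * gam * h * h + 3 * Gam * e1 * h).
      { apply Rmult_le_compat_l with (r := F) in Hn; [|lra].
        assert (Hn' : F * N (x (s + h)) <= N (x s) + F * (gam * c * h + Gam * e1 * h)).
        { eapply Rle_trans; [exact Hn|]. right. rewrite <- Hgc.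
          rewrite Rmult_plus_distr_l, <- Rmult_assoc, HFinv. ring. }
        assert (H5 : (1 + gam * h) * (1 - gam * h) <= F * (1 - gam * h))
          by (apply Rmult_le_compat_r; lra).
        assert (H6 : c * ((1 + gam * h) * (1 - gam * h)) <= c * (F * (1 - gam * h)))
          by (apply Rmult_le_compat_l; lra).
        assert (H7 : 0 <= Gam * e1 * h)
          by (apply Rmult_le_pos; [apply Rmult_le_pos|]; lra).
        assert (H8 : F * (Gam * e1 * h) <= 3 * (Gam * e1 * h))
          by (apply Rmult_le_compat_r; lra).
        nra. }
      assert (Hfin : Es * (c * gam * gam * h * h + 3 * Gam * e1 * h) <= e * h).
      { assert (H1' : E * (3 * Gam * e1) = e / 2) by (unfold e1; field; lra).
        assert (H2' : E * ((c * gam * gam + 1) * d') = e / 2)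
          by (unfold d'; field; lra).
        assert (H3' : c * gam * gam * h <= (c * gam * gam + 1) * d')
          by (apply Rmult_le_compat; lra).
        assert (H7 : 0 <= c * gam * gam * h) by (apply Rmult_le_pos; lra).
        assert (H8 : 0 <= 3 * Gam * e1) by (apply Rmult_le_pos; lra).
        replace (Es * (c * gam * gam * h * h + 3 * Gam * e1 * h))
          with (Es * (c * gam * gam * h + 3 * Gam * e1) * h) by ring.
        apply Rmult_le_compat_r; [lra|].
        apply Rle_trans with (E * (c * gam * gam * h + 3 * Gam * e1)).
        - apply Rmult_le_compat_r; lra.
        - apply Rmult_le_compat_l with (r := E) in H3'; [|lra]. lra. }
      apply Rmult_le_compat_l with (r := Es) in Hmain; [|lra]. nra. }
  unfold p in Hp. rewrite Rmult_0_r, exp_0, Rabs_R0, Rabs_right in Hp by lra.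
  replace (- gam * a) with (- (gam * a)) by ring. rewrite exp_Ropp.
  pose proof (exp_pos (gam * a)) as HE.
  apply Rmult_le_reg_l with (exp (gam * a)); [exact HE|].
  replace (exp (gam * a) * (/ exp (gam * a) * N (x 0) + c * (1 - / exp (gam * a))))
    with (N (x 0) + c * exp (gam * a) - c) by (field; lra). lra.
Qed.

End Decay.

(** * Real inner products and the Riesz representation *)

Record real_inner {V : CompleteNormedModule R_AbsRing} (ip : V -> V -> R) : Prop := {
  real_inner_plus_l : forall x y z, ip (plus x y) z = ip x z + ip y z;
  real_inner_scal_l : forall r x y, ip (scal r x) y = r * ip x y;
  real_inner_sym : forall x y, ip x y = ip y x;
  real_inner_self : forall x, ip x x = norm x ^ 2
}.

Section InnerProduct.

Context {V : CompleteNormedModule R_AbsRing} {ip : V -> V -> R}.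
Hypothesis Hip : real_inner ip.

Lemma real_inner_minus_l (x y z : V) : ip (minus x y) z = ip x z - ip y z.
Proof.
  replace (minus x y) with (plus x (scal (-1) y)) by linear_module.
  rewrite (real_inner_plus_l ip Hip), (real_inner_scal_l ip Hip). ring.
Qed.

Lemma real_inner_plus_r (x y z : V) : ip x (plus y z) = ip x y + ip x z.
Proof.
  rewrite !(real_inner_sym ip Hip x). apply (real_inner_plus_l ip Hip).
Qed.

Lemma real_inner_scal_r (r : R) (x y : V) : ip x (scal r y) = r * ip x y.
Proof.
  rewrite !(real_inner_sym ip Hip x). apply (real_inner_scal_l ip Hip).
Qed.

Lemma real_inner_minus_r (x y z : V) : ip x (minus y z) = ip x y - ip x z.
Proof.
  rewrite !(real_inner_sym ip Hip x). apply real_inner_minus_l.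
Qed.

Lemma norm_plus_sq (x y : V) :
  norm (plus x y) ^ 2 = norm x ^ 2 + 2 * ip x y + norm y ^ 2.
Proof.
  rewrite <- !(real_inner_self ip Hip).
  rewrite (real_inner_plus_l ip Hip), !real_inner_plus_r, (real_inner_sym ip Hip y x).
  ring.
Qed.

Lemma real_inner_le (x y : V) : Rabs (ip x y) <= norm x * norm y.
Proof.
  pose proof (norm_nonneg x) as Hx. pose proof (norm_nonneg y) as Hy.
  assert (H : forall t, 0 <= norm x ^ 2 + 2 * (t * ip x y) + t ^ 2 * norm y ^ 2).
  { intros t.
    replace (norm x ^ 2 + 2 * (t * ip x y) + t ^ 2 * norm y ^ 2)
      with (norm (plus x (scal t y)) ^ 2); [apply pow2_ge_0|].
    rewrite norm_plus_sq, real_inner_scal_r.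
    rewrite <- !(real_inner_self ip Hip), (real_inner_scal_l ip Hip), real_inner_scal_r.
    ring. }
  destruct (Req_dec (norm y) 0) as [H0|H0].
  - assert (ip x y = 0) as ->; [|rewrite Rabs_R0; nra].
    rewrite H0 in H.
    pose proof (H ((- norm x ^ 2 - 1) / 2 * / ip x y)) as H1.
    apply NNPP. intros Hne.
    replace (norm x ^ 2 + 2 * ((- norm x ^ 2 - 1) / 2 * / ip x y * ip x y) +
      ((- norm x ^ 2 - 1) / 2 * / ip x y) ^ 2 * 0 ^ 2) with (-1) in H1 by (field; exact Hne).
    lra.
  - specialize (H (- ip x y / norm y ^ 2)).
    replace (norm x ^ 2 + 2 * (- ip x y / norm y ^ 2 * ip x y) +
      (- ip x y / norm y ^ 2) ^ 2 * norm y ^ 2)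
      with ((norm x ^ 2 * norm y ^ 2 - ip x y ^ 2) / norm y ^ 2) in H by (field; lra).
    assert (Hp : 0 < norm y ^ 2) by (apply pow_lt; lra).
    apply Rmult_le_compat_r with (r := norm y ^ 2) in H; [|lra].
    replace ((norm x ^ 2 * norm y ^ 2 - ip x y ^ 2) / norm y ^ 2 * norm y ^ 2)
      with (norm x ^ 2 * norm y ^ 2 - ip x y ^ 2) in H by (field; lra).
    rewrite <- (Rabs_pos_eq (norm x * norm y)) by now apply Rmult_le_pos.
    apply Rsqr_le_abs_0. unfold Rsqr. nra.
Qed.

(** The representing vector minimizes [norm x ^ 2 - 2 * l x] over the closed
    subspace [P]: by the parallelogram law minimizing sequences are Cauchy.
    For [P] the whole space this is the Riesz representation of [l], for
    [l = fun x => ip x y] it is the orthogonal projection of [y] onto [P]. *)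
Lemma riesz_on_closed_subspace (P : V -> Prop) (l : V -> R) (C : R) :
  P zero ->
  (forall x y, P x -> P y -> P (plus x y)) ->
  (forall r x, P x -> P (scal r x)) ->
  (forall x, (forall e, 0 < e -> exists y, P y /\ norm (minus y x) < e) -> P x) ->
  (forall x y, l (plus x y) = l x + l y) ->
  (forall r x, l (scal r x) = r * l x) ->
  (forall x, Rabs (l x) <= C * norm x) ->
  exists p, P p /\ forall x, P x -> ip x p = l x.
Proof.
  intros HP0 HPp HPs HPc Hlp Hls Hlb.
  set (J := fun x => norm x ^ 2 - 2 * l x).
  destruct (completeness (fun r => exists x, P x /\ r = - J x)) as [m [Hub Hlub]].
  { exists (C ^ 2). intros r (x & _ & ->). unfold J.
    specialize (Hlb x). apply Rabs_le_between in Hlb.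
    pose proof (pow2_ge_0 (norm x - C)). nra. }
  { exists (- J zero). now exists zero. }
  assert (HJm : forall x, P x -> - m <= J x).
  { intros x Hx. assert (- J x <= m) by (apply Hub; now exists x). lra. }
  assert (Hmin : forall n, exists x, P x /\ J x <= - m + / (INR n + 1)).
  { intros n. apply NNPP. intros Hn.
    assert (Hpos : 0 < / (INR n + 1))
      by (apply Rinv_0_lt_compat; pose proof (pos_INR n); lra).
    assert (m <= m - / (INR n + 1)); [|lra].
    apply Hlub. intros r (x & Hx & ->). apply Rnot_lt_le. intros Hlt.
    apply Hn. exists x. split; [exact Hx|lra]. }
  pose (xs := fun n => proj1_sig (constructive_indefinite_description _ (Hmin n))).
  assert (Hxs : forall n, P (xs n) /\ J (xs n) <= - m + / (INR n + 1)).
  { intros n. exact (proj2_sig (constructive_indefinite_description _ (Hmin n))). }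
  assert (Hsmall : forall e, 0 < e -> exists n, forall k, (n <= k)%nat -> / (INR k + 1) < e).
  { intros e He. destruct (nfloor_ex (/ e)) as [n Hn]; [left; now apply Rinv_0_lt_compat|].
    exists n. intros k Hk. apply le_INR in Hk. rewrite <- (Rinv_inv e).
    apply Rinv_lt_contravar; [|lra].
    apply Rmult_lt_0_compat; [now apply Rinv_0_lt_compat|].
    pose proof (pos_INR k). lra. }
  destruct (cauchy_sequence_converges xs) as [p Hp].
  { intros e He. destruct (Hsmall (e ^ 2 / 4)) as [n Hn].
    { apply Rdiv_lt_0_compat; [now apply pow_lt|lra]. }
    exists n. intros i j Hi Hj. specialize (Hn i Hi) as Hni. specialize (Hn j Hj).
    destruct (Hxs i) as [Pi Ji]. destruct (Hxs j) as [Pj Jj].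
    pose proof (HJm (scal (/ 2) (plus (xs i) (xs j)))
                  (HPs _ _ (HPp _ _ Pi Pj))) as Hmid.
    unfold J in Ji, Jj, Hmid.
    rewrite norm_scal_eq, Rabs_right, Hls, Hlp, Rpow_mult_distr, norm_plus_sq in Hmid by lra.
    assert (Hsq : norm (minus (xs i) (xs j)) ^ 2
                  = norm (xs i) ^ 2 - 2 * ip (xs i) (xs j) + norm (xs j) ^ 2).
    { rewrite <- !(real_inner_self ip Hip).
      rewrite real_inner_minus_l, !real_inner_minus_r, (real_inner_sym ip Hip (xs j) (xs i)).
      ring. }
    apply Rnot_le_lt. intros Hle. pose proof (pow_incr e _ 2 (conj (Rlt_le _ _ He) Hle)).
    lra. }
  assert (HPp' : P p).
  { apply HPc. intros e He. destruct (Hp e He) as [n Hn].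
    exists (xs n). split; [apply Hxs|now apply Hn]. }
  exists p. split; [exact HPp'|]. intros x Hx.
  set (D := ip x p - l x). set (q := norm x ^ 2 + 1).
  assert (Hq : 0 < q) by (unfold q; pose proof (pow2_ge_0 (norm x)); lra).
  (* Variation of the minimizing sequence in the direction [x]. The best step would
     be [- D / norm x ^ 2]; [q] replaces a denominator that may vanish. *)
  set (t := - D / q).
  assert (Hvar : forall e, 0 < e -> D ^ 2 / q <= e).
  { intros e He.
    set (b := 2 * Rabs t * norm x + 1).
    assert (Hb : 0 < b).
    { unfold b. pose proof (Rabs_pos t). pose proof (norm_nonneg x).
      assert (0 <= Rabs t * norm x) by now apply Rmult_le_pos. lra. }
    destruct (Hsmall (e / 2)) as [n Hn]; [lra|].
    destruct (Hp (e / 2 / b)) as [n' Hn']; [repeat apply Rdiv_lt_0_compat; lra|].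
    set (k := (n + n')%nat). specialize (Hn k ltac:(lia)). specialize (Hn' k ltac:(lia)).
    destruct (Hxs k) as [Pk Jk].
    pose proof (HJm (plus (xs k) (scal t x)) (HPp _ _ Pk (HPs _ _ Hx))) as H.
    unfold J in H, Jk. rewrite norm_plus_sq, Hlp, Hls, real_inner_scal_r in H.
    rewrite norm_scal_eq, Rpow_mult_distr, pow2_abs in H.
    rewrite (real_inner_sym ip Hip (xs k) x) in H.
    replace (ip x (xs k)) with (ip x p + ip x (minus (xs k) p)) in H
      by (rewrite real_inner_minus_r; ring).
    assert (Hsm : 2 * (t * ip x (minus (xs k) p)) <= e / 2).
    { pose proof (real_inner_le x (minus (xs k) p)) as Hcs.
      eapply Rle_trans; [apply Rle_abs|]. rewrite !Rabs_mult, (Rabs_right 2) by lra.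
      apply Rle_trans with (b * (e / 2 / b)); [|right; field; lra].
      apply Rle_trans with (2 * (Rabs t * norm x) * norm (minus (xs k) p)).
      - rewrite Rmult_assoc. apply Rmult_le_compat_l; [lra|]. rewrite Rmult_assoc.
        apply Rmult_le_compat_l; [apply Rabs_pos|exact Hcs].
      - pose proof (Rabs_pos t). pose proof (norm_nonneg x).
        assert (0 <= Rabs t * norm x) by now apply Rmult_le_pos.
        apply Rmult_le_compat; [lra|apply norm_nonneg|unfold b; lra|lra]. }
    assert (Hquad : 2 * (t * D) + t ^ 2 * norm x ^ 2 <= - (D ^ 2 / q)).
    { replace (norm x ^ 2) with (q - 1) by (unfold q; ring).
      replace (2 * (t * D) + t ^ 2 * (q - 1)) with (- (D ^ 2 / q) - t ^ 2)
        by (unfold t; field; lra).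
      pose proof (pow2_ge_0 t). lra. }
    unfold D in Hquad at 1. lra. }
  assert (HD : D ^ 2 / q <= 0) by (apply le_epsilon; intros e He; rewrite Rplus_0_l; auto).
  apply Rmult_le_compat_r with (r := q) in HD; [|lra].
  replace (D ^ 2 / q * q) with (D ^ 2) in HD by (field; lra).
  assert (D = 0) by nra. unfold D in *. lra.
Qed.

Lemma riesz_representation (l : V -> R) (C : R) :
  (forall x y, l (plus x y) = l x + l y) ->
  (forall r x, l (scal r x) = r * l x) ->
  (forall x, Rabs (l x) <= C * norm x) ->
  exists p, forall x, ip x p = l x.
Proof.
  intros Hp Hs Hb.
  destruct (riesz_on_closed_subspace (fun _ => True) l C) as (p & _ & H);
    try tauto. exists p. intros x. now apply H.
Qed.

(** * Norm continuity of [F (T t)] at 0 for compact [F] *)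

(** The adjoint semigroup is strongly continuous. The vectors [y] for which the
    claim holds form a closed subspace [Y]. If [z] is orthogonal to [Y], the
    vectors representing [x |-> ip (orbit_integral 0 h x) z] are in [Y], because
    [orbit_integral 0 h (T t x - x)] is of order [t]. Hence they are orthogonal to
    [z], while after division by [h] they tend weakly to [z]; so [z] is zero. *)
Lemma adjoint_semigroup_continuous {T : R -> V -> V} (HT : semigroup T) (y : V) (e : R) :
  0 < e -> exists d, 0 < d /\ forall t x, 0 < t < d ->
    Rabs (ip (minus (T t x) x) y) <= e * norm x.
Proof.
  revert e.
  set (Y := fun y => forall e, 0 < e -> exists d, 0 < d /\ forall t x, 0 < t < d ->
              Rabs (ip (minus (T t x) x) y) <= e * norm x).
  change (Y y).
  destruct (semigroup_bounded HT 1) as (M & HM & HMb).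
  assert (HY0 : Y zero).
  { intros e He. exists 1. split; [lra|]. intros t x _.
    replace (@zero (CompleteNormedModule.AbelianMonoid _ V)) with (scal 0 y)
      by linear_module.
    rewrite real_inner_scal_r, Rmult_0_l, Rabs_R0.
    apply Rmult_le_pos; [lra|apply norm_nonneg]. }
  assert (HYp : forall u v, Y u -> Y v -> Y (plus u v)).
  { intros u v Hu Hv e He.
    destruct (Hu (e / 2)) as (d1 & Hd1 & H1); [lra|].
    destruct (Hv (e / 2)) as (d2 & Hd2 & H2); [lra|].
    exists (Rmin d1 d2). split; [now apply Rmin_pos|]. intros t x Ht.
    pose proof (Rmin_l d1 d2). pose proof (Rmin_r d1 d2).
    specialize (H1 t x ltac:(lra)). specialize (H2 t x ltac:(lra)).
    rewrite real_inner_plus_r. eapply Rle_trans; [apply Rabs_triang|]. lra. }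
  assert (HYs : forall r u, Y u -> Y (scal r u)).
  { intros r u Hu e He. pose proof (Rabs_pos r).
    destruct (Hu (e / (Rabs r + 1))) as (d & Hd & H1); [apply Rdiv_lt_0_compat; lra|].
    exists d. split; [exact Hd|]. intros t x Ht. specialize (H1 t x Ht).
    rewrite real_inner_scal_r, Rabs_mult.
    apply Rle_trans with ((Rabs r + 1) * (e / (Rabs r + 1) * norm x));
      [|right; field; lra].
    apply Rmult_le_compat; try apply Rabs_pos; lra. }
  assert (HYc : forall u, (forall e, 0 < e -> exists v, Y v /\ norm (minus v u) < e) -> Y u).
  { intros u Hu e He.
    destruct (Hu (e / 2 / (M + 1))) as (v & Hv & Hvu);
      [repeat apply Rdiv_lt_0_compat; lra|].
    destruct (Hv (e / 2)) as (d & Hd & H1); [lra|].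
    exists (Rmin d 1). split; [apply Rmin_pos; lra|]. intros t x Ht.
    pose proof (Rmin_l d 1). pose proof (Rmin_r d 1).
    specialize (H1 t x ltac:(lra)).
    replace (ip (minus (T t x) x) u)
      with (ip (minus (T t x) x) v - ip (minus (T t x) x) (minus v u))
      by (rewrite real_inner_minus_r; ring).
    eapply Rle_trans; [apply Rabs_triang|]. rewrite Rabs_Ropp.
    pose proof (real_inner_le (minus (T t x) x) (minus v u)) as Hcs.
    pose proof (norm_minus_le (T t x) x). specialize (HMb t x ltac:(lra)).
    assert (norm (minus (T t x) x) * norm (minus v u)
            <= (M + 1) * norm x * (e / 2 / (M + 1))).
    { apply Rmult_le_compat; try apply norm_nonneg; lra. }
    replace ((M + 1) * norm x * (e / 2 / (M + 1))) with (e / 2 * norm x) in * by (field; lra).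
    lra. }
  destruct (riesz_on_closed_subspace Y (fun x => ip x y) (norm y)) as (p & Hp & Hproj);
    try assumption.
  { intros; apply (real_inner_plus_l ip Hip). }
  { intros; apply (real_inner_scal_l ip Hip). }
  { intros x. rewrite Rmult_comm. apply real_inner_le. }
  set (z := minus y p).
  assert (Hz : forall x, Y x -> ip x z = 0).
  { intros x Hx. unfold z. rewrite real_inner_minus_r, (Hproj x Hx). ring. }
  assert (HJ : forall h, 0 < h <= 1 -> ip (orbit_integral (T := T) 0 h z) z = 0).
  { intros h Hh.
    pose proof (orbit_integral_linear HT h ltac:(lra)) as Hlin.
    destruct (riesz_representation (fun x => ip (orbit_integral (T := T) 0 h x) z)
                (h * M * norm z)) as [zh Hzh].
    { intros u v. rewrite (lin_plus Hlin). apply (real_inner_plus_l ip Hip). }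
    { intros r u. rewrite (lin_scal Hlin). apply (real_inner_scal_l ip Hip). }
    { intros x. eapply Rle_trans; [apply real_inner_le|].
      pose proof (orbit_integral_bound HT 0 h M x ltac:(lra)
                    (fun t Ht => HMb t x ltac:(lra))) as Hb.
      apply Rmult_le_compat_r with (r := norm z) in Hb; [|apply norm_nonneg]. lra. }
    rewrite <- Hzh, (real_inner_sym ip Hip). apply Hz.
    intros e He. destruct (semigroup_bounded HT 2) as (M2 & HM2 & HM2b).
    pose proof (norm_nonneg z) as Hnz.
    set (d := e / (2 * M2 * (norm z + 1))).
    assert (Hd : 0 < d).
    { apply Rdiv_lt_0_compat; [lra|]. repeat apply Rmult_lt_0_compat; lra. }
    exists (Rmin d 1). split; [apply Rmin_pos; lra|]. intros t x Ht.
    pose proof (Rmin_l d 1). pose proof (Rmin_r d 1).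
    rewrite Hzh, (lin_minus Hlin), (orbit_integral_increment HT) by lra.
    match goal with |- Rabs (ip ?u z) <= _ => replace u
      with (minus (orbit_integral (T := T) h (h + t) x) (orbit_integral (T := T) 0 t x))
        by linear_module end.
    pose proof (orbit_integral_bound HT h (h + t) M2 x ltac:(lra)
                  (fun s Hs => HM2b s x ltac:(lra))) as H1.
    pose proof (orbit_integral_bound HT 0 t M2 x ltac:(lra)
                  (fun s Hs => HM2b s x ltac:(lra))) as H2.
    replace (h + t - h) with t in H1 by ring. rewrite Rminus_0_r in H2.
    eapply Rle_trans; [apply real_inner_le|].
    apply Rle_trans with (2 * t * (M2 * norm x) * (norm z + 1)).
    - apply Rmult_le_compat; try apply norm_nonneg; [|lra].
      eapply Rle_trans; [apply norm_minus_le|]. lra.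
    - replace (e * norm x) with (2 * d * (M2 * norm x) * (norm z + 1))
        by (unfold d; field; lra).
      apply Rmult_le_compat_r; [lra|].
      apply Rmult_le_compat_r; [|lra].
      apply Rmult_le_pos; [lra|apply norm_nonneg]. }
  assert (Hz0 : norm z = 0).
  { pose proof (norm_nonneg z) as Hnz.
    assert (Hle : forall e, 0 < e -> norm z ^ 2 <= e * norm z).
    { intros e He.
      destruct (orbit_integral_mean HT 0 z e) as (d & Hd & Hmean); [lra|exact He|].
      set (h := Rmin (d / 2) 1).
      assert (Hh : 0 < h /\ h < d /\ h <= 1).
      { unfold h. pose proof (Rmin_l (d / 2) 1). pose proof (Rmin_r (d / 2) 1).
        repeat split; [apply Rmin_pos; lra|lra|lra]. }
      specialize (HJ h ltac:(lra)). specialize (Hmean h ltac:(lra)).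
      rewrite (semigroup_zero T HT), Rminus_0_r in Hmean.
      pose proof (real_inner_le (minus (orbit_integral (T := T) 0 h z) (scal h z)) z) as Hcs.
      rewrite real_inner_minus_l, HJ, (real_inner_scal_l ip Hip), (real_inner_self ip Hip)
        in Hcs.
      rewrite Rminus_0_l, Rabs_Ropp, Rabs_right in Hcs
        by (apply Rle_ge, Rmult_le_pos; [lra|apply pow2_ge_0]).
      apply Rmult_le_compat_r with (r := norm z) in Hmean; [|lra].
      apply Rmult_le_reg_l with h; lra. }
    destruct (Rle_lt_or_eq_dec _ _ Hnz) as [Hpos|]; [|lra].
    specialize (Hle (norm z / 2) ltac:(lra)). nra. }
  replace y with (plus p z) by (unfold z; linear_module).
  apply norm_zero_inv in Hz0. rewrite Hz0. now apply HYp.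
Qed.

End InnerProduct.

(** By adjoint continuity [ip (F (T t x - x)) u] is small uniformly on the unit
    ball for each fixed [u], hence for the finitely many [u] of a net. As
    [F (T t x - x)] stays in a totally bounded set, some [u] in the net is close
    to it, and the inner product is close to its squared norm. *)
Lemma compact_semigroup_norm_continuous {V W : CompleteNormedModule R_AbsRing}
    {ip : V -> V -> R} {ipW : W -> W -> R} {T : R -> V -> V} {F : V -> W} :
  real_inner ip -> real_inner ipW -> semigroup T -> is_linear F ->
  (forall d, 0 < d -> exists l : list W, forall x, norm x <= 1 ->
     exists u, In u l /\ norm (minus (F x) u) < d) ->
  forall e, 0 < e -> exists d, 0 < d /\ forall t x, 0 < t < d ->
    norm (F (minus (T t x) x)) <= e * norm x.
Proof.
  intros Hip HipW HT HF Hnet e He.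
  destruct (linear_norm F HF) as (bF & HbF & HFb).
  change (forall x : V, norm (F x) <= bF * norm x) in HFb.
  destruct (semigroup_bounded HT 1) as (M & HM & HMb).
  set (r := M + 1). assert (Hr : 0 < r) by (unfold r; lra).
  assert (Hweak : forall u e, 0 < e -> exists d, 0 < d /\ forall t x, 0 < t < d ->
             Rabs (ipW (F (minus (T t x) x)) u) <= e * norm x).
  { intros u e1 He1.
    destruct (riesz_representation Hip (fun x => ipW (F x) u) (bF * norm u)) as [yu Hyu].
    { intros x y. rewrite (lin_plus HF). apply (real_inner_plus_l ipW HipW). }
    { intros k x. rewrite (lin_scal HF). apply (real_inner_scal_l ipW HipW). }
    { intros x. eapply Rle_trans; [apply (real_inner_le HipW)|].
      specialize (HFb x). apply Rmult_le_compat_r with (r := norm u) in HFb;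
        [|apply norm_nonneg]. lra. }
    destruct (adjoint_semigroup_continuous Hip HT yu e1 He1) as (d & Hd & H).
    exists d. split; [exact Hd|]. intros t x Ht. rewrite <- Hyu. now apply H. }
  assert (Hlist : forall (l : list W) e, 0 < e -> exists d, 0 < d /\
             forall u t x, In u l -> 0 < t < d ->
             Rabs (ipW (F (minus (T t x) x)) u) <= e * norm x).
  { intros l e1 He1. induction l as [|v l (d & Hd & IH)].
    - exists 1. split; [lra|]. intros u t x [].
    - destruct (Hweak v e1 He1) as (d' & Hd' & H).
      exists (Rmin d d'). split; [now apply Rmin_pos|]. intros u t x Hu Ht.
      pose proof (Rmin_l d d'). pose proof (Rmin_r d d').
      destruct Hu as [<-|Hu]; [apply H; lra|apply IH; [exact Hu|lra]]. }
  destruct (Hnet (e ^ 2 / (2 * r ^ 2) / bF)) as [l Hl].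
  { assert (0 < e ^ 2) by now apply pow_lt. assert (0 < r ^ 2) by now apply pow_lt.
    repeat apply Rdiv_lt_0_compat; lra. }
  destruct (Hlist l (e ^ 2 / (2 * r))) as (d & Hd & H).
  { assert (0 < e ^ 2) by now apply pow_lt. apply Rdiv_lt_0_compat; lra. }
  exists (Rmin d 1). split; [apply Rmin_pos; lra|]. intros t x Ht.
  pose proof (Rmin_l d 1). pose proof (Rmin_r d 1).
  set (w := minus (T t x) x).
  pose proof (norm_nonneg x) as Hx.
  assert (Hw : norm w <= r * norm x).
  { eapply Rle_trans; [apply norm_minus_le|].
    specialize (HMb t x ltac:(lra)). unfold r. lra. }
  destruct (Req_dec (norm x) 0) as [Hx0|Hx0].
  { eapply Rle_trans; [apply HFb|]. rewrite Hx0, Rmult_0_r in *. nra. }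
  set (c := / (r * norm x)).
  assert (Hc : 0 < c) by (apply Rinv_0_lt_compat, Rmult_lt_0_compat; lra).
  assert (Hcrx : c * (r * norm x) = 1) by (unfold c; field; lra).
  assert (Hcw : norm (scal c w) <= 1).
  { rewrite norm_scal_pos by lra.
    apply Rmult_le_compat_l with (r := c) in Hw; lra. }
  destruct (Hl _ Hcw) as (u & Hu & Hdist).
  specialize (H u t x Hu ltac:(lra)). fold w in H.
  set (v := F (scal c w)) in *.
  assert (Hv : norm v <= bF) by (eapply Rle_trans; [apply HFb|]; nra).
  assert (Hsq : norm v ^ 2 <= (e / r) ^ 2).
  { rewrite <- (real_inner_self ipW HipW).
    replace (ipW v v) with (ipW v (minus v u) + ipW v u)
      by (rewrite (real_inner_minus_r HipW); ring).
    pose proof (real_inner_le HipW v (minus v u)) as Hcs.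
    apply Rabs_le_between in Hcs.
    assert (Hn1 : norm v * norm (minus v u) <= bF * (e ^ 2 / (2 * r ^ 2) / bF))
      by (apply Rmult_le_compat; try apply norm_nonneg; lra).
    replace (bF * (e ^ 2 / (2 * r ^ 2) / bF)) with (e ^ 2 / (2 * r ^ 2)) in Hn1 by (field; lra).
    assert (Hn2 : ipW v u <= e ^ 2 / (2 * r ^ 2)).
    { unfold v. rewrite (lin_scal HF), (real_inner_scal_l ipW HipW).
      apply Rabs_le_between in H. destruct H as [_ H].
      apply Rmult_le_compat_l with (r := c) in H; [|lra].
      eapply Rle_trans; [exact H|]. right. unfold c. field. lra. }
    replace ((e / r) ^ 2) with (e ^ 2 / (2 * r ^ 2) + e ^ 2 / (2 * r ^ 2)) by (field; lra).
    lra. }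
  assert (Her : 0 < e / r) by (apply Rdiv_lt_0_compat; lra).
  assert (Hv2 : norm v <= e / r).
  { apply Rnot_lt_le. intros Hlt.
    assert ((e / r) ^ 2 < norm v ^ 2); [|lra].
    simpl. rewrite !Rmult_1_r. apply Rmult_le_0_lt_compat; lra. }
  unfold v in Hv2. rewrite (lin_scal HF), norm_scal_pos in Hv2 by lra.
  apply Rmult_le_reg_l with c; [exact Hc|].
  eapply Rle_trans; [exact Hv2|]. right. unfold c. field. lra.
Qed.

(** * Mild solutions between two updating times *)

Section SamplingInterval.

Context {V W : CompleteNormedModule R_AbsRing}.
Context {T : R -> V -> V} {B : W -> V} {F : V -> W} {phi : V -> V}.
Context {tau_max M bB bF L : R}.
Hypothesis HT : semigroup T.
Hypothesis HF : is_linear F.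
Hypothesis Htau : 0 < tau_max.
Hypothesis HM1 : 1 <= M.
Hypothesis HM : forall t x, 0 <= t <= tau_max -> norm (T t x) <= M * norm x.
Hypothesis HbB : 0 < bB.
Hypothesis HB : forall u, norm (B u) <= bB * norm u.
Hypothesis HbF : 0 < bF.
Hypothesis HFb : forall x, norm (F x) <= bF * norm x.
Hypothesis HL : 0 <= L.
Hypothesis Hphi0 : phi zero = zero.
Hypothesis Hphi : forall x y, norm (minus (phi x) (phi y)) <= L * norm (minus x y).
(* Makes the nonlinear term a contraction on the whole interval, so that suprema
   can be absorbed and no Gronwall estimate is needed. *)
Hypothesis HLsmall : M * L * tau_max <= 1 / 2.

Definition forcing (z : R -> V) (s : R) : V := plus (B (F (z 0))) (phi (z s)).

(** Convertible with [mild_formula] when [V] is a [realification], so that the two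
    can be interchanged without proof. *)
Definition mild_at (z : R -> V) (t : R) : Prop :=
  exists I, is_RInt (fun s => T (t - s) (forcing z s)) 0 t I /\
    z t = plus (T t (z 0)) I.

(** The maximum [m] of the norm of a solution satisfies
    [m <= M * (1 + tau_max * (bB * bF)) * norm (z 0) + m / 2]. *)
Definition growth_constant : R := 2 * M * (1 + tau_max * (bB * bF)).

Lemma growth_constant_ge1 : 1 <= growth_constant.
Proof.
  unfold growth_constant.
  assert (0 <= tau_max * (bB * bF)).
  { apply Rmult_le_pos; [lra|]. apply Rmult_le_pos; lra. }
  nra.
Qed.

Lemma norm_phi_le (x : V) : norm (phi x) <= L * norm x.
Proof.
  pose proof (Hphi x zero) as H. rewrite Hphi0 in H.
  replace (phi x) with (minus (phi x) zero) by linear_module.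
  eapply Rle_trans; [exact H|]. right. do 2 f_equal. linear_module.
Qed.

Lemma norm_forcing_le (z : R -> V) (s : R) :
  norm (forcing z s) <= bB * bF * norm (z 0) + L * norm (z s).
Proof.
  unfold forcing. eapply Rle_trans; [apply norm_plus_le|].
  apply Rplus_le_compat; [|apply norm_phi_le].
  eapply Rle_trans; [apply HB|]. rewrite Rmult_assoc.
  apply Rmult_le_compat_l; [lra|apply HFb].
Qed.

Lemma mild_at_zero (z : R -> V) : mild_at z 0.
Proof.
  exists zero. split.
  - apply (is_RInt_point (fun s => T (0 - s) (forcing z s)) 0).
  - rewrite (semigroup_zero T HT). linear_module.
Qed.

Section Trajectory.

Context {z : R -> V} {d : R}.
Hypothesis Hz : continuous_nonneg z.
Hypothesis Hd : 0 <= d <= tau_max.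
Hypothesis Hmild : forall t, 0 < t <= d -> mild_at z t.

Lemma mild_at_le (t : R) : 0 <= t <= d -> mild_at z t.
Proof.
  intros Ht. destruct (Req_dec t 0) as [->|]; [apply mild_at_zero|].
  apply Hmild. lra.
Qed.

Lemma mild_growth (t : R) :
  0 <= t <= d -> norm (z t) <= growth_constant * norm (z 0).
Proof.
  intros Ht. destruct (norm_attains_max z d (proj1 Hd) Hz) as (m & Hm & Hmax).
  eapply Rle_trans; [now apply Hmax|].
  destruct (mild_at_le m Hm) as (I & HI & Hzm).
  assert (HIb : norm I <= (m - 0) * (M * (bB * bF * norm (z 0) + L * norm (z m)))).
  { apply (norm_RInt_le_const (fun s => T (m - s) (forcing z s)) 0 m I _ (proj1 Hm));
      [|exact HI].
    intros s Hs. eapply Rle_trans; [apply HM; lra|].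
    apply Rmult_le_compat_l; [lra|].
    eapply Rle_trans; [apply norm_forcing_le|].
    specialize (Hmax s ltac:(lra)). nra. }
  assert (Hzb : norm (z m) <= M * norm (z 0) + norm I).
  { rewrite Hzm at 1. eapply Rle_trans; [apply norm_plus_le|].
    specialize (HM m (z 0) ltac:(lra)). lra. }
  pose proof (norm_nonneg (z 0)) as H0. pose proof (norm_nonneg (z m)) as H1.
  rewrite Rminus_0_r in HIb.
  assert (H2 : m * (M * (bB * bF * norm (z 0) + L * norm (z m)))
               <= tau_max * (M * (bB * bF * norm (z 0) + L * norm (z m)))).
  { apply Rmult_le_compat_r; [|lra]. apply Rmult_le_pos; [lra|].
    apply Rplus_le_le_0_compat; repeat apply Rmult_le_pos; lra. }
  assert (H3 : M * L * tau_max * norm (z m) <= 1 / 2 * norm (z m))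
    by (apply Rmult_le_compat_r; lra).
  unfold growth_constant. nra.
Qed.

Lemma mild_increment (s h : R) :
  0 <= s -> 0 <= h -> s + h <= d ->
  exists I, is_RInt (fun r => T (s + h - r) (forcing z r)) s (s + h) I /\
    z (s + h) = plus (T h (z s)) I.
Proof.
  intros Hs Hh Hsh.
  destruct (mild_at_le s ltac:(lra)) as (I1 & HI1 & Hz1).
  destruct (mild_at_le (s + h) ltac:(lra)) as (I2 & HI2 & Hz2).
  destruct (ex_RInt_Chasles_2 (fun r => T (s + h - r) (forcing z r)) 0 s (s + h))
    as [I HI]; [lra|now exists I2|].
  exists I. split; [exact HI|].
  assert (HhI : is_RInt (fun r => T (s + h - r) (forcing z r)) 0 s (T h I1)).
  { apply is_RInt_ext with (f := fun r => T h (T (s - r) (forcing z r))).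
    - intros r Hr. rewrite Rmin_left, Rmax_right in Hr by lra.
      rewrite <- (semigroup_add T HT) by lra. f_equal. ring.
    - apply (is_RInt_linear (T h) (fun r => T (s - r) (forcing z r)));
        [now apply (semigroup_linear T HT)|exact HI1]. }
  assert (HI2' : I2 = plus (T h I1) I).
  { apply (is_RInt_fun_unique (fun r => T (s + h - r) (forcing z r)) 0 (s + h));
      [exact HI2|].
    exact (is_RInt_Chasles (fun r => T (s + h - r) (forcing z r)) _ _ _ _ _ HhI HI). }
  rewrite Hz2, HI2', Hz1 at 1.
  rewrite (semigroup_plus HT) by lra. rewrite (Rplus_comm s h), (semigroup_add T HT) by lra.
  linear_module.
Qed.

(** The sampling error is [T t (z 0) - z 0] plus an integral over [0, t]; only the
    image of the first part under [F] is small, which [eta] expresses. *)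
Lemma sampling_error_le (t eta : R) :
  0 <= t <= d -> norm (F (minus (T t (z 0)) (z 0))) <= eta * norm (z 0) ->
  norm (F (minus (z 0) (z t)))
  <= (eta + bF * (t * (M * (bB * bF + L * growth_constant)))) * norm (z 0).
Proof.
  intros Ht Heta. destruct (mild_at_le t Ht) as (I & HI & Hzt).
  assert (HIb : norm I <= (t - 0) * (M * ((bB * bF + L * growth_constant) * norm (z 0)))).
  { apply (norm_RInt_le_const (fun s => T (t - s) (forcing z s)) 0 t I _ (proj1 Ht));
      [|exact HI].
    intros s Hs. eapply Rle_trans; [apply HM; lra|].
    apply Rmult_le_compat_l; [lra|].
    eapply Rle_trans; [apply norm_forcing_le|].
    pose proof (mild_growth s ltac:(lra)). nra. }
  rewrite (lin_minus HF), norm_minus_sym, <- (lin_minus HF), Hzt.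
  replace (minus (plus (T t (z 0)) I) (z 0)) with (plus (minus (T t (z 0)) (z 0)) I)
    by linear_module.
  rewrite (lin_plus HF). eapply Rle_trans; [apply norm_plus_le|].
  specialize (HFb I). apply Rmult_le_compat_l with (r := bF) in HIb; [|lra]. nra.
Qed.

(** In terms of the semigroup [S] of the ideal feedback [B F], the solution is
    driven only by the sampling error and the nonlinearity. The expansion replaces
    the variation of constants formula for [S]. *)
Lemma mild_expansion {S : R -> V -> V} (HS : semigroup S)
    (HBlin : is_linear B)
    (HTS : forall y v, generator_value T y v -> generator_value S y (plus v (B (F y))))
    (s e : R) :
  0 <= s < d -> 0 < e -> exists r, 0 < r /\ forall h, 0 < h < r ->
    norm (minus (minus (z (s + h)) (S h (z s)))
            (scal h (plus (B (F (minus (z 0) (z s)))) (phi (z s))))) <= e * h.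
Proof.
  intros Hs He.
  assert (HK : is_linear (fun x => B (F x))) by exact (is_linear_comp F B HF HBlin).
  destruct (semigroup_difference_derivative HT HS HK HTS (z s) (e / 2))
    as (r1 & Hr1 & H1); [lra|].
  destruct (semigroup_right_continuous T HT (forcing z s) (e / 4)) as (r2 & Hr2 & H2); [lra|].
  assert (HML : 0 <= M * L) by (apply Rmult_le_pos; lra).
  destruct (Hz s ltac:(lra) (e / 4 / (M * L + 1))) as (r3 & Hr3 & H3);
    [repeat apply Rdiv_lt_0_compat; lra|].
  exists (Rmin (Rmin r1 r2) (Rmin r3 (d - s))).
  split; [repeat apply Rmin_pos; lra|]. intros h Hh.
  pose proof (Rmin_l (Rmin r1 r2) (Rmin r3 (d - s))).
  pose proof (Rmin_r (Rmin r1 r2) (Rmin r3 (d - s))).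
  pose proof (Rmin_l r1 r2). pose proof (Rmin_r r1 r2).
  pose proof (Rmin_l r3 (d - s)). pose proof (Rmin_r r3 (d - s)).
  destruct (mild_increment s h) as (I & HI & Hzh); try lra.
  specialize (H1 h ltac:(lra)).
  assert (HIe : norm (minus I (scal (s + h - s) (forcing z s))) <= (s + h - s) * (e / 2)).
  { apply (is_RInt_near_const _ s (s + h) I (forcing z s) (e / 2) ltac:(lra) HI).
    intros r Hr.
    assert (Ha1 : norm (minus (T (s + h - r) (forcing z s)) (forcing z s)) <= e / 4).
    { destruct (Req_dec r (s + h)) as [->|Hne].
      - rewrite Rminus_diag, (semigroup_zero T HT), norm_minus_self. lra.
      - left. apply H2. lra. }
    assert (Ha2 : norm (minus (T (s + h - r) (forcing z r)) (T (s + h - r) (forcing z s)))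
                 <= e / 4).
    { rewrite <- (semigroup_minus HT) by lra.
      eapply Rle_trans; [apply HM; lra|].
      replace (minus (forcing z r) (forcing z s)) with (minus (phi (z r)) (phi (z s)))
        by (unfold forcing; linear_module).
      specialize (H3 r ltac:(lra) ltac:(apply Rabs_def1; lra)).
      specialize (Hphi (z r) (z s)).
      apply Rle_trans with (M * L * norm (minus (z r) (z s))).
      - rewrite Rmult_assoc. apply Rmult_le_compat_l; lra.
      - apply Rle_trans with ((M * L + 1) * (e / 4 / (M * L + 1))); [|right; field; lra].
        apply Rmult_le_compat; try apply norm_nonneg; lra. }
    pose proof (norm_minus_triangle (T (s + h - r) (forcing z r))
                  (T (s + h - r) (forcing z s)) (forcing z s)). lra. }
  replace (s + h - s) with h in HIe by ring.
  replace (minus (minus (z (s + h)) (S h (z s)))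
             (scal h (plus (B (F (minus (z 0) (z s)))) (phi (z s)))))
    with (plus (plus (minus (T h (z s)) (S h (z s))) (scal h (B (F (z s)))))
               (minus I (scal h (forcing z s)))).
  2:{ rewrite Hzh, (lin_minus HF), (lin_minus HBlin). unfold forcing. linear_module. }
  eapply Rle_trans; [apply norm_plus_le|]. lra.
Qed.

End Trajectory.

Lemma mild_unique (z z' : R -> V) (d : R) :
  continuous_nonneg z -> continuous_nonneg z' -> 0 <= d <= tau_max ->
  (forall t, 0 < t <= d -> mild_at z t) ->
  (forall t, 0 < t <= d -> mild_at z' t) ->
  z 0 = z' 0 -> forall t, 0 <= t <= d -> z t = z' t.
Proof.
  intros Hz Hz' Hd Hm Hm' H0 t Ht.
  destruct (norm_attains_max (fun s => minus (z s) (z' s)) d (proj1 Hd)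
              (continuous_nonneg_minus z z' Hz Hz')) as (m & Hmd & Hmax).
  simpl in Hmax.
  assert (Hzero : norm (minus (z m) (z' m)) = 0).
  { destruct (mild_at_le Hm m Hmd) as (I & HI & Hzm).
    destruct (mild_at_le Hm' m Hmd) as (I' & HI' & Hzm').
    assert (HIb : norm (minus I I') <= (m - 0) * (M * (L * norm (minus (z m) (z' m))))).
    { apply (norm_RInt_le_const
               (fun s => minus (T (m - s) (forcing z s)) (T (m - s) (forcing z' s)))
               0 m _ _ (proj1 Hmd)).
      - intros s Hs. cbv beta.
        rewrite <- (semigroup_minus HT) by lra.
        eapply Rle_trans; [apply HM; lra|].
        apply Rmult_le_compat_l; [lra|].
        replace (minus (forcing z s) (forcing z' s)) with (minus (phi (z s)) (phi (z' s)))
          by (unfold forcing; rewrite H0; linear_module).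
        eapply Rle_trans; [apply Hphi|].
        apply Rmult_le_compat_l; [exact HL|]. apply Hmax. lra.
      - exact (is_RInt_minus (fun s => T (m - s) (forcing z s))
                 (fun s => T (m - s) (forcing z' s)) 0 m I I' HI HI'). }
    assert (Heq : minus (z m) (z' m) = minus I I').
    { rewrite Hzm, Hzm', H0. linear_module. }
    rewrite <- Heq, Rminus_0_r in HIb.
    pose proof (norm_nonneg (minus (z m) (z' m))) as Hn.
    assert (H2 : m * (M * (L * norm (minus (z m) (z' m))))
                 <= tau_max * (M * (L * norm (minus (z m) (z' m))))).
    { apply Rmult_le_compat_r; [|lra]. repeat apply Rmult_le_pos; lra. }
    assert (H3 : M * L * tau_max * norm (minus (z m) (z' m))
                 <= 1 / 2 * norm (minus (z m) (z' m)))
      by (apply Rmult_le_compat_r; lra).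
    lra. }
  specialize (Hmax t Ht). rewrite Hzero in Hmax.
  assert (Ht0 : minus (z t) (z' t) = zero).
  { apply norm_zero_inv. pose proof (norm_nonneg (minus (z t) (z' t))). lra. }
  replace (z t) with (plus (minus (z t) (z' t)) (z' t)) by linear_module.
  rewrite Ht0. linear_module.
Qed.

(** The smallness condition makes the forcing term at most [gam / (2 * Gam)] times
    the sampled state, which costs half of the decay gained in the adapted norm. *)
Lemma sampling_interval_decay {S : R -> V -> V} {Gam gam : R} (N : V -> R)
    (z : R -> V) (d kappa : R) :
  semigroup S -> is_linear B ->
  (forall y v, generator_value T y v -> generator_value S y (plus v (B (F y)))) ->
  0 < gam -> 0 < Gam ->
  (forall x, norm x <= N x <= Gam * norm x) ->
  (forall x y, N (plus x y) <= N x + N y) ->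
  (forall h x, 0 <= h -> N (S h x) <= exp (- gam * h) * N x) ->
  continuous_nonneg z -> 0 <= d <= tau_max ->
  (forall t, 0 < t <= d -> mild_at z t) ->
  0 <= kappa ->
  (forall s, 0 <= s < d -> norm (F (minus (z 0) (z s))) <= kappa * norm (z 0)) ->
  bB * kappa + L * growth_constant <= gam / (2 * Gam) ->
  N (z d) <= (1 + exp (- gam * d)) / 2 * N (z 0).
Proof.
  intros HS HBlin HTS Hgam HGam HN1 HNplus HNS Hz Hd Hm Hkappa Herr Hsmall.
  pose proof growth_constant_ge1 as HC.
  pose proof (norm_nonneg (z 0)) as Hz0.
  assert (HLC : 0 <= L * growth_constant) by (apply Rmult_le_pos; lra).
  assert (HbBk : 0 <= bB * kappa) by (apply Rmult_le_pos; lra).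
  eapply Rle_trans.
  - apply (adapted_norm_decay (S := S) (Gam := Gam) Hgam N z
             (fun s => plus (B (F (minus (z 0) (z s)))) (phi (z s))) d
             ((bB * kappa + L * growth_constant) * norm (z 0))); try assumption.
    + lra.
    + intros s Hs. eapply Rle_trans; [apply norm_plus_le|].
      rewrite Rmult_plus_distr_r. apply Rplus_le_compat.
      * eapply Rle_trans; [apply HB|]. rewrite Rmult_assoc.
        apply Rmult_le_compat_l; [lra|]. now apply Herr.
      * eapply Rle_trans; [apply norm_phi_le|]. rewrite Rmult_assoc.
        apply Rmult_le_compat_l; [exact HL|]. apply (mild_growth Hz Hd Hm). lra.
    + apply Rmult_le_pos; lra.
    + intros s Hs e He. now apply (mild_expansion Hz Hd Hm HS HBlin HTS).
  - assert (HE : exp (- gam * d) <= 1).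
    { rewrite <- exp_0. apply exp_nondecreasing.
      assert (0 <= gam * d) by (apply Rmult_le_pos; lra). lra. }
    assert (Hhalf : Gam * ((bB * kappa + L * growth_constant) * norm (z 0)) / gam
                    <= / 2 * N (z 0)).
    { apply Rle_trans with (Gam * (gam / (2 * Gam) * N (z 0)) / gam); [|right; field; lra].
      apply Rmult_le_compat_r; [left; now apply Rinv_0_lt_compat|].
      apply Rmult_le_compat_l; [lra|]. destruct (HN1 (z 0)) as [HN _].
      apply Rmult_le_compat; lra. }
    apply Rmult_le_compat_r with (r := 1 - exp (- gam * d)) in Hhalf; [|lra]. lra.
Qed.

End SamplingInterval.

(** [rho] is the contraction per interval; no interval is longer than [tau_max]
    and none shorter than [tau_min], so the number of intervals up to time [s]
    is finite and at least [s / tau_max - 1]. *)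
Lemma decay_along_updating_times (t : nat -> R) (v : R -> R) (rho tau_min tau_max : R) :
  0 < rho < 1 -> 0 < tau_min -> 0 < tau_max -> t O = 0 ->
  (forall n, tau_min <= t (S n) - t n <= tau_max) ->
  (forall n s, 0 <= s <= t (S n) - t n -> v (t n + s) <= v (t n)) ->
  (forall n, v (t (S n)) <= rho * v (t n)) -> 0 <= v 0 ->
  forall s, 0 <= s -> v s <= / rho * exp (- (- ln rho / tau_max) * s) * v 0.
Proof.
  intros Hrho Hmin Hmax Ht0 Hstep Hin Hnext Hv0 s Hs.
  assert (Hlow : forall n, INR n * tau_min <= t n).
  { induction n as [|n IH]; [simpl; lra|]. rewrite S_INR. specialize (Hstep n). lra. }
  assert (Hup : forall n, t n <= INR n * tau_max).
  { induction n as [|n IH]; [simpl; lra|]. rewrite S_INR. specialize (Hstep n). lra. }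
  assert (Hgeo : forall n, v (t n) <= rho ^ n * v 0).
  { induction n as [|n IH]; [rewrite Ht0; simpl; lra|]. specialize (Hnext n).
    apply Rmult_le_compat_l with (r := rho) in IH; [|lra]. simpl. lra. }
  assert (Hfind : forall n, s < t n -> exists m, t m <= s < t (S m)).
  { induction n as [|n IH]; intros Hn; [lra|].
    destruct (Rle_dec (t n) s) as [H|H]; [exists n; lra|apply IH; lra]. }
  destruct (nfloor_ex (s / tau_min)) as [k Hk].
  { apply Rdiv_le_0_compat; lra. }
  destruct (Hfind (S k)) as (n & Hn).
  { eapply Rlt_le_trans; [|apply Hlow]. rewrite S_INR.
    destruct Hk as [_ Hk]. apply Rmult_lt_compat_r with (r := tau_min) in Hk; [|lra].
    replace (s / tau_min * tau_min) with s in Hk by (field; lra). exact Hk. }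
  replace s with (t n + (s - t n)) at 1 by ring.
  eapply Rle_trans; [apply Hin; lra|]. eapply Rle_trans; [apply Hgeo|].
  apply Rmult_le_compat_r; [exact Hv0|].
  assert (Hln : ln rho < 0) by (rewrite <- ln_1; apply ln_increasing; lra).
  assert (Hpow : rho ^ S n = exp (INR (S n) * ln rho)).
  { rewrite <- Rpower_pow by lra. reflexivity. }
  apply Rmult_le_reg_l with rho; [lra|].
  rewrite <- Rmult_assoc, Rinv_r, Rmult_1_l by lra.
  change (rho * rho ^ n) with (rho ^ S n). rewrite Hpow.
  assert (Hsn : s <= INR (S n) * tau_max) by (specialize (Hup (S n)); lra).
  assert (Hexp : INR (S n) * ln rho <= - (- ln rho / tau_max) * s).
  { replace (- (- ln rho / tau_max) * s) with (- (- ln rho / tau_max * s)) by ring.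
    apply Ropp_le_cancel. rewrite Ropp_involutive.
    replace (- (INR (S n) * ln rho)) with (- ln rho / tau_max * (INR (S n) * tau_max))
      by (field; lra).
    apply Rmult_le_compat_l; [|exact Hsn]. left. apply Rdiv_lt_0_compat; lra. }
  now apply exp_nondecreasing.
Qed.

(** * Restriction of scalars *)

Section Realify.

Context {k : scalar_field}.

Lemma is_linear_realification {X Y : CompleteNormedModule (scalars k)} (l : X -> Y) :
  is_linear l -> is_linear (U := realification X) (V := realification Y) l.
Proof.
  intros [Hp Hs Hn]. split.
  - exact Hp.
  - intros r x. exact (Hs (of_real k r) x).
  - exact Hn.
Qed.

Definition real_part : scalars k -> R :=
  match k with RealScalars => fun r => r | ComplexScalars => fst end.

Lemma real_inner_realification (X : Hilbert k) :
  real_inner (V := realification X) (fun x y => real_part (inner X x y)).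
Proof.
  split.
  - intros x y z.
    transitivity (real_part (plus (inner X x z) (inner X y z))).
    + f_equal. exact (inner_plus_l k X x y z).
    + unfold real_part. destruct k; reflexivity.
  - intros r x y.
    transitivity (real_part (mult (of_real k r) (inner X x y))).
    + f_equal. exact (inner_scal_l k X (of_real k r) x y).
    + generalize (inner X x y). unfold real_part.
      destruct k; simpl; [reflexivity|]. intros c. unfold mult; simpl. ring.
  - intros x y. rewrite (inner_conj k X x y). generalize (inner X x y).
    unfold real_part. destruct k; reflexivity.
  - intros x. rewrite (inner_norm k X x).
    transitivity (@norm _ X x ^ 2); [|reflexivity].
    generalize (@norm _ X x). unfold real_part. destruct k; reflexivity.
Qed.

Lemma semigroup_realification {X : Hilbert k} (T : R -> X -> X) :
  C0_semigroup T -> semigroup (V := realification X) T.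
Proof.
  intros (Hlin & H0 & Hadd & Hcont). split.
  - intros t Ht. now apply is_linear_realification, Hlin.
  - exact H0.
  - exact Hadd.
  - intros x. exact (proj1 (filterlim_at_right_norm (fun t => T t x) x) (Hcont x)).
Qed.

Lemma generator_value_filterlim {X : Hilbert k} (T : R -> X -> X) (y z : X) :
  generator_value (V := realification X) T y z <->
  filterlim (fun h => scal (of_real k (/ h)) (minus (T h y) y)) (at_right 0) (locally z).
Proof.
  exact (iff_trans (generator_value_quotient (V := realification X) T y z)
           (iff_sym (filterlim_at_right_norm
              (fun h => scal (of_real k (/ h)) (minus (T h y) y)) z))).
Qed.

End Realify.

Lemma op_norm_bound {V W : CompleteNormedModule R_AbsRing} (f : V -> W) (c : R) :
  (forall r x, f (scal r x) = scal r (f x)) ->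
  Rbar_le (op_norm f) c -> forall x, norm (f x) <= c * norm x.
Proof.
  intros Hs Hc.
  assert (Hunit : forall y, norm y <= 1 -> norm (f y) <= c).
  { intros y Hy. apply (Rbar_le_trans (norm (f y)) (op_norm f) c); [|exact Hc].
    apply (proj1 (Lub_Rbar_correct _)). now exists y. }
  intros x. destruct (norm_nonneg x) as [Hx|Hx].
  - assert (Hix : 0 < / norm x) by now apply Rinv_0_lt_compat.
    specialize (Hunit (scal (/ norm x) x)).
    rewrite Hs, !norm_scal_pos, Rinv_l in Hunit by lra.
    specialize (Hunit (Rle_refl 1)).
    apply Rmult_le_reg_l with (/ norm x); [exact Hix|].
    replace (/ norm x * (c * norm x)) with c by (field; lra). exact Hunit.
  - assert (Hx0 : x = scal 0 x).
    { symmetry in Hx. apply norm_zero_inv in Hx. rewrite Hx. linear_module. }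
    rewrite Hx0, Hs, !norm_scal_pos by lra. lra.
Qed.

(** Balls of radius [d] around all points form an open cover of the compact closure
    of the image of the unit ball. *)
Lemma compact_operator_finite_net {k : scalar_field} {X Y : Hilbert k} (F : X -> Y) (d : R) :
  compact_operator F -> 0 < d ->
  exists l : list Y, forall x, norm x <= 1 ->
    exists u, In u l /\ norm (minus (F x) u) < d.
Proof.
  intros [_ Hc] Hd.
  destruct (Hc Y (fun u v => norm (minus v u) < d)) as [l Hl].
  - intros u v Hv.
    apply (locally_le_locally_norm v).
    assert (He : 0 < d - norm (minus v u)) by lra.
    exists (mkposreal _ He). intros w Hw. unfold ball_norm in Hw. simpl in Hw.
    rewrite (minus_trans v w u).
    eapply Rle_lt_trans; [apply norm_triangle|]. lra.
  - intros u _. exists u. eapply Rle_lt_trans; [right|exact Hd].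
    exact (norm_minus_self (V := realification Y) u).
  - exists l. intros x Hx. apply Hl. intros P HP. exists (F x).
    split; [now apply locally_singleton|now exists x].
Qed.

(** * The event-triggering mechanism *)

(** Before the infimum [trigger_time] the triggering inequality fails, except during
    the first [tau_min] time units, when it is not tested. *)
Lemma updating_time_bounds {k : scalar_field} {X : Hilbert k}
    (eps tau_min tau_max tk tk' : R) (z : R -> X) :
  0 < tau_min < tau_max ->
  Finite tk' = Rbar_min (tk + tau_max) (trigger_time eps tau_min tk z) ->
  tau_min <= tk' - tk <= tau_max /\
  forall s, tau_min < s < tk' - tk -> norm (minus (z 0) (z s)) <= eps * norm (z 0).
Proof.
  intros Htau Heq.
  destruct (Glb_Rbar_correct (fun t => t > tk + tau_min /\
    norm (minus (z 0) (z (t - tk))) > eps * norm (z 0))) as [Hlb Hglb].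
  fold (trigger_time eps tau_min tk z) in Hlb, Hglb.
  assert (Hlow : Rbar_le (tk + tau_min) (trigger_time eps tau_min tk z)).
  { apply Hglb. intros t [Ht _]. simpl. lra. }
  assert (Hle : Rbar_le tk' (trigger_time eps tau_min tk z) /\ tk' <= tk + tau_max
                /\ tk + tau_min <= tk').
  { revert Heq Hlow. destruct (trigger_time eps tau_min tk z) as [r| |]; simpl;
      intros Heq Hlow; try easy; injection Heq as ->.
    - pose proof (Rmin_l (tk + tau_max) r). pose proof (Rmin_r (tk + tau_max) r).
      repeat split; [lra|lra|]. apply Rmin_glb; lra.
    - repeat split; lra. }
  split; [lra|]. intros s Hs. apply Rnot_lt_le. intros Hlt.
  assert (Hts : Rbar_le (trigger_time eps tau_min tk z) (tk + s)).
  { apply Hlb. split; [lra|]. now replace (tk + s - tk) with s by ring. }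
  pose proof (Rbar_le_trans _ _ _ (proj1 Hle) Hts) as H. simpl in H. lra.
Qed.

Theorem theorem2p9 (k : scalar_field) (X U : Hilbert k)
    (D : X -> Prop) (A : X -> X) (T : R -> X -> X)
    (B : U -> X) (F : X -> U) (TBF : R -> X -> X)
    (hA : generates D A T)
    (hB : is_linear B)
    (hF : compact_operator F)
    (hABF : generates D (fun x => plus (A x) (B (F x))) TBF)
    (hstab : exp_stable_semigroup TBF) :
  forall tau_max : R, 0 < tau_max ->
  exists Lstar eps_star tau_min_star : R,
    0 < Lstar /\ 0 < eps_star /\ 0 < tau_min_star < tau_max /\
    forall L : R, 0 <= L <= Lstar ->
    forall phi : X -> X, phi zero = zero -> lipschitz L phi ->
    forall eps : R, 0 <= eps <= eps_star ->
    forall tau_min : R, 0 < tau_min <= tau_min_star ->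
    closed_loop_exp_stable T B F phi eps tau_min tau_max.
Proof.
  intros tau_max Htau.
  set (V := realification X). set (W := realification U).
  assert (HT : semigroup (V := V) T) by (apply semigroup_realification, hA).
  assert (HS : semigroup (V := V) TBF) by (apply semigroup_realification, hABF).
  assert (HB : is_linear (U := W) (V := V) B) by now apply is_linear_realification.
  assert (HF : is_linear (U := V) (V := W) F) by (apply is_linear_realification, hF).
  assert (HTS : forall y v : V, generator_value (V := V) T y v ->
             generator_value (V := V) TBF y (plus v (B (F y)))).
  { intros y v Hy.
    apply (proj1 (generator_value_filterlim T y v)) in Hy.
    apply (proj2 hA) in Hy. destruct Hy as [Dy <-].
    apply (proj2 (generator_value_filterlim TBF y _)).
    apply (proj2 hABF). now split. }
  destruct hstab as (Gam & gam & HGam & Hgam & Hdecay).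
  assert (HSb : forall t (x : V), 0 <= t -> norm (TBF t x) <= Gam * exp (- gam * t) * norm x).
  { intros t x Ht. apply (op_norm_bound (V := V) (W := V) (TBF t)).
    - intros r y. apply (lin_scal (semigroup_linear (V := V) TBF HS t Ht)).
    - exact (Hdecay t Ht). }
  destruct (adapted_norm_exists HS HSb) as (N & HN1 & HNplus & HNS).
  destruct (semigroup_bounded HT tau_max) as (M & HM1 & HM).
  destruct (linear_norm _ HB) as (bB & HbB & HBb).
  destruct (linear_norm _ HF) as (bF & HbF & HFb).
  set (C := growth_constant (tau_max := tau_max) (M := M) (bB := bB) (bF := bF)).
  assert (HC : 1 <= C) by now apply growth_constant_ge1.
  (* Half of the margin [gam / (2 * Gam)] goes to the nonlinearity, half to the
     sampling error [kappa]. *)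
  set (q := gam / (4 * Gam)).
  assert (Hq : 0 < q) by (apply Rdiv_lt_0_compat; lra).
  set (kappa := q / bB).
  assert (Hkappa : 0 < kappa) by now apply Rdiv_lt_0_compat.
  destruct (compact_semigroup_norm_continuous (real_inner_realification X)
              (real_inner_realification U) HT HF
              (fun d Hd => compact_operator_finite_net F d hF Hd) (kappa / 2))
    as (tF & HtF & HFT); [lra|].
  assert (HbBF : 0 < bB * bF) by now apply Rmult_lt_0_compat.
  assert (HbM : 0 < bF * (M * (bB * bF + q))).
  { repeat apply Rmult_lt_0_compat; lra. }
  set (t2 := kappa / 2 / (bF * (M * (bB * bF + q)))).
  assert (Ht2 : 0 < t2) by (apply Rdiv_lt_0_compat; lra).
  assert (HMt : 0 < M * tau_max) by (apply Rmult_lt_0_compat; lra).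
  exists (Rmin (/ (2 * (M * tau_max))) (q / C)), (kappa / bF),
    (Rmin (Rmin (tF / 2) t2) (tau_max / 2)).
  split.
  { apply Rmin_pos; [apply Rinv_0_lt_compat; lra|apply Rdiv_lt_0_compat; lra]. }
  split; [now apply Rdiv_lt_0_compat|].
  split.
  { split; [repeat apply Rmin_pos; lra|].
    eapply Rle_lt_trans; [apply Rmin_r|]. lra. }
  intros L HL phi Hphi0 Hphi eps Heps tau_min Hmin.
  assert (HL1 : L <= / (2 * (M * tau_max)))
    by (eapply Rle_trans; [apply HL|apply Rmin_l]).
  assert (HL2 : L <= q / C) by (eapply Rle_trans; [apply HL|apply Rmin_r]).
  assert (HLM : M * L * tau_max <= 1 / 2).
  { apply Rmult_le_compat_r with (r := M * tau_max) in HL1; [|lra].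
    replace (/ (2 * (M * tau_max)) * (M * tau_max)) with (1 / 2) in HL1 by (field; lra).
    lra. }
  assert (HLC : L * C <= q).
  { apply Rmult_le_compat_r with (r := C) in HL2; [|lra].
    replace (q / C * C) with q in HL2 by (field; lra). exact HL2. }
  assert (Hmin1 : tau_min <= Rmin (tF / 2) t2)
    by (eapply Rle_trans; [apply Hmin|apply Rmin_l]).
  assert (Hmin2 : tau_min <= tau_max / 2)
    by (eapply Rle_trans; [apply Hmin|apply Rmin_r]).
  assert (HmintF : tau_min < tF) by (pose proof (Rmin_l (tF / 2) t2); lra).
  assert (Hmint2 : tau_min <= t2) by (pose proof (Rmin_r (tF / 2) t2); lra).
  set (rho := (1 + exp (- gam * tau_min)) / 2).
  assert (Hrho : 0 < rho < 1).
  { unfold rho. pose proof (exp_pos (- gam * tau_min)).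
    assert (exp (- gam * tau_min) < 1).
    { rewrite <- exp_0. apply exp_increasing.
      assert (0 < gam * tau_min) by (apply Rmult_lt_0_compat; lra). lra. }
    lra. }
  assert (Hlnrho : ln rho < 0) by (rewrite <- ln_1; apply ln_increasing; lra).
  exists (/ rho * Gam), (- ln rho / tau_max).
  split; [|split].
  { rewrite <- (Rmult_1_l 1). apply Rmult_le_compat; try lra.
    rewrite <- Rinv_1. apply Rinv_le_contravar; lra. }
  { apply Rdiv_lt_0_compat; lra. }
  (* The stability constants may depend on [tau_min], which bounds the contraction
     factor [rho] per interval away from 1. *)
  intros x0 t x (Hxc & Hx0 & Ht0 & Hloop) s Hs.
  assert (Hx : continuous_nonneg (V := V) x) by exact (continuous_on_nonneg_norm x Hxc).
  assert (Hinterval : forall n, 0 <= t n ->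
    tau_min <= t (S n) - t n <= tau_max /\
    forall tau, 0 <= tau <= t (S n) - t n ->
      N (x (t n + tau)) <= (1 + exp (- gam * tau)) / 2 * N (x (t n))).
  { intros n Htn. destruct (Hloop n) as (Hmild & z & (Hzc & Hz0 & Hzmild) & Htime).
    destruct (updating_time_bounds eps tau_min tau_max (t n) (t (S n)) z
                ltac:(lra) Htime) as (Hbounds & Htrig).
    split; [exact Hbounds|]. intros tau Htau'.
    assert (Hz : continuous_nonneg (V := V) z) by exact (continuous_on_nonneg_norm z Hzc).
    set (y := fun r => x (t n + r)).
    assert (Hy : continuous_nonneg (V := V) y) by now apply continuous_nonneg_shift.
    assert (Hy0 : y 0 = x (t n)) by (unfold y; now rewrite Rplus_0_r).
    assert (Hymild : forall r, 0 < r <= t (S n) - t n ->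
              mild_at (V := V) (W := W) (T := T) (B := B) (F := F) (phi := phi) y r)
      by exact Hmild.
    assert (Hzmild' : forall r, 0 < r <= t (S n) - t n ->
              mild_at (V := V) (W := W) (T := T) (B := B) (F := F) (phi := phi) z r)
      by (intros r Hr; apply Hzmild; lra).
    assert (Hyz : forall r, 0 <= r <= t (S n) - t n -> y r = z r).
    { apply (mild_unique (V := V) (W := W) HT HM1 HM (proj1 HL) Hphi HLM
               y z (t (S n) - t n) Hy Hz ltac:(lra) Hymild Hzmild').
      now rewrite Hy0, Hz0. }
    rewrite <- Hy0.
    apply (sampling_interval_decay (V := V) (W := W) (Gam := Gam) HT HF Htau HM1 HM HbB HBb HbF HFb
             (proj1 HL) Hphi0 Hphi HLM N y tau kappa HS HB HTS Hgam); try assumption.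
    - lra.
    - lra.
    - intros r Hr. apply Hymild. lra.
    - lra.
    - intros r Hr. destruct (Rle_dec r tau_min) as [Hrt|Hrt].
      + eapply Rle_trans.
        * apply (sampling_error_le (V := V) (W := W) (d := t (S n) - t n) HT HF HM1 HM HbB HBb HbF HFb
                   (proj1 HL) Hphi0 Hphi HLM Hy ltac:(lra) Hymild r (kappa / 2)); [lra|].
          destruct (Req_dec r 0) as [->|Hr0].
          -- rewrite (semigroup_zero (V := V) T HT).
             eapply Rle_trans; [apply HFb|]. rewrite norm_minus_self, Rmult_0_r.
             apply Rmult_le_pos; [lra|apply (norm_nonneg (V := V))].
          -- apply HFT. lra.
        * apply Rmult_le_compat_r; [apply (norm_nonneg (V := V))|].
          fold C.
          assert (H : r * (bF * (M * (bB * bF + L * C)))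
                      <= t2 * (bF * (M * (bB * bF + q)))).
          { assert (0 <= L * C) by (apply Rmult_le_pos; lra).
            apply Rmult_le_compat; [lra| |lra|].
            - repeat apply Rmult_le_pos; lra.
            - repeat (apply Rmult_le_compat_l; [lra|]). lra. }
          replace (t2 * (bF * (M * (bB * bF + q)))) with (kappa / 2) in H
            by (unfold t2; field; repeat split; lra).
          lra.
      + eapply Rle_trans; [apply HFb|].
        assert (Herr : norm (minus (y 0) (y r)) <= eps * norm (y 0)).
        { rewrite !Hyz by lra. apply Htrig. lra. }
        apply Rle_trans with (bF * (kappa / bF * norm (V := V) (y 0))); [|right; field; lra].
        apply Rmult_le_compat_l; [lra|]. eapply Rle_trans; [exact Herr|].
        apply Rmult_le_compat_r; [apply (norm_nonneg (V := V))|lra].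
    - fold C. replace (bB * kappa) with q by (unfold kappa; field; lra).
      replace (gam / (2 * Gam)) with (q + q) by (unfold q; field; lra). lra. }
  assert (Htpos : forall n, 0 <= t n).
  { induction n as [|n IH]; [lra|]. destruct (Hinterval n IH) as [Hb _]. lra. }
  assert (HNpos : forall v : V, 0 <= N v).
  { intros v. eapply Rle_trans; [apply (norm_nonneg (V := V) v)|apply HN1]. }
  assert (Hdec : N (x s) <= / rho * exp (- (- ln rho / tau_max) * s) * N (x 0)).
  { apply (decay_along_updating_times t (fun r => N (x r)) rho tau_min tau_max);
      try lra; try apply HNpos.
    - intros n. apply (Hinterval n (Htpos n)).
    - intros n r Hr. destruct (Hinterval n (Htpos n)) as [_ H].
      eapply Rle_trans; [now apply H|].
      rewrite <- (Rmult_1_l (N (x (t n)))) at 2.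
      apply Rmult_le_compat_r; [apply HNpos|].
      assert (exp (- gam * r) <= 1); [|lra].
      rewrite <- exp_0. apply exp_nondecreasing. assert (0 <= gam * r) by (apply Rmult_le_pos; lra). lra.
    - intros n. destruct (Hinterval n (Htpos n)) as [Hb H].
      specialize (H (t (S n) - t n) ltac:(lra)).
      replace (t n + (t (S n) - t n)) with (t (S n)) in H by ring.
      eapply Rle_trans; [exact H|]. apply Rmult_le_compat_r; [apply HNpos|].
      unfold rho.
      assert (exp (- gam * (t (S n) - t n)) <= exp (- gam * tau_min)); [|lra].
      apply exp_nondecreasing. assert (gam * tau_min <= gam * (t (S n) - t n))
        by (apply Rmult_le_compat_l; lra). lra. }
  rewrite Hx0 in Hdec.
  eapply Rle_trans; [apply (HN1 (x s))|]. eapply Rle_trans; [exact Hdec|].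
  replace (/ rho * Gam * exp (- (- ln rho / tau_max) * s) * norm x0)
    with (/ rho * exp (- (- ln rho / tau_max) * s) * (Gam * norm x0)) by ring.
  apply Rmult_le_compat_l; [|apply (HN1 x0)].
  apply Rmult_le_pos; [left; apply Rinv_0_lt_compat; lra|left; apply exp_pos].
Qed.
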